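(* Let $\{\alpha_i\}_{i\in\mathbb{N}_0}\subset[0,\infty)$ be such that $0=\alpha_0<\alpha_1<\alpha_2<\dots$, let $\mathcal{F}=\{x^{\alpha_i}\}_{i\in\mathbb{N}_0}$, considered on $[0,\infty)$, and let $L:\operatorname{lin}\mathcal{F}\to\mathbb{R}$ be a linear functional. Then the following are equivalent: (i) $L$ is a $[0,\infty)$-moment functional. (ii) $L(p)\ge 0$ for all $p\in\operatorname{lin}\mathcal{F}$ with $p\ge 0$ on $[0,\infty)$. (iii) $L(p)\ge 0$ for all $p\in\operatorname{lin}\mathcal{F}$ with $p>0$ on $[0,\infty)$. (iv) $L(p)\ge 0$ for each of the following kinds of $p$: $$p(x)=\det\begin{pmatrix} 1&x^{\alpha_1}&x^{\alpha_2}&\dots&x^{\alpha_{2m-1}}&x^{\alpha_{2m}}\\ x&(x_1&x_1)&\dots&(x_m&x_m)\end{pmatrix},$$ $$p(x)=\det\begin{pmatrix} x^{\alpha_1}&x^{\alpha_2}&x^{\alpha_3}&\dots&x^{\alpha_{2m-2}}&x^{\alpha_{2m-1}}\\ x&(x_1&x_1)&\dots&(x_{m-1}&x_{m-1})\end{pmatrix}\quad(m\ge 1),$$ $$p(x)=\det\begin{pmatrix} x^{\alpha_1}&x^{\alpha_2}&x^{\alpha_3}&\dots&x^{\alpha_{2m}}&x^{\alpha_{2m+1}}\\ x&(x_1&x_1)&\dots&(x_m&x_m)\end{pmatrix},$$ for all $m\in\mathbb{N}_0$ and all $0<x_1<\dots<x_m$.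
   Context: $\mathbb{N}_0=\{0,1,2,\dots\}$. $\operatorname{lin}\mathcal{F}$ is the real vector space of finite linear combinations of the functions in $\mathcal{F}$; $x^0=1$ is the constant function, and $0^\alpha=0$ for $\alpha>0$. $L$ is a $[0,\infty)$-moment functional if there is a (positive) measure $\mu$ on $[0,\infty)$ with $L(f)=\int_0^\infty f\,d\mu$ for all $f\in\operatorname{lin}\mathcal{F}$. Matrix notation: for functions $g_0,\dots,g_k$ and points $z_0,\dots,z_k$, $\begin{pmatrix} g_0&\dots&g_k\\ z_0&\dots&z_k\end{pmatrix}$ denotes the $(k+1)\times(k+1)$ matrix whose row belonging to the point $z_j$ is $(g_0(z_j),\dots,g_k(z_j))$. A bracketed pair $(z\ \ z)$ in the bottom line stands for two consecutive rows: $(g_0(z),\dots,g_k(z))$ followed by the row of derivatives $(g_0'(z),\dots,g_k'(z))$. In the top line $x^{\alpha_i}$ denotes the function $t\mapsto t^{\alpha_i}$; the bottom-line entry $x$ is the variable of $p$. For $m=0$ there are no points $x_i$: the first determinant is the constant $1$ and the third is $x^{\alpha_1}$; for $m=1$ the second determinant is $x^{\alpha_1}$. *)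

(* Defs.v *)
From HB Require Import structures.
From mathcomp Require Import all_boot all_order all_algebra.
From mathcomp Require Import all_classical all_reals all_analysis.

Set Implicit Arguments.
Unset Strict Implicit.
Unset Printing Implicit Defensive.

Import Order.TTheory GRing.Theory Num.Theory.
Import numFieldNormedType.Exports.

Local Open Scope classical_set_scope.
Local Open Scope ring_scope.

Section LinearSpan.
Context (K : pzRingType) (V : lmodType K) (F : set V).

Definition lin_set : set V :=
  [set v | exists (n : nat) (c : 'I_n -> K) (u : 'I_n -> V),
     (forall i, F (u i)) /\ v = \sum_(i < n) c i *: u i].

Definition lin_pred : {pred V} := fun v => `[< lin_set v >].

Lemma lin_predP (v : V) : reflect (lin_set v) (v \in lin_pred).
Proof. exact: asboolP. Qed.

Lemma lin_submod_closed : submod_closed lin_pred.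
Proof.
split.
  by apply/lin_predP; exists 0%N, (fun=> 0), (fun=> 0); split=> [[]//|];
    rewrite big_ord0.
move=> a v w /lin_predP[n [c [u [Fu ->]]]] /lin_predP[m [d [t [Ft ->]]]].
apply/lin_predP; exists (n + m)%N.
exists (fun i => match fintype.split i with inl j => a * c j | inr j => d j end).
exists (fun i => match fintype.split i with inl j => u j | inr j => t j end).
split=> [i|]; first by case: (fintype.split i).
rewrite big_split_ord /= scaler_sumr; congr (_ + _); apply: eq_bigr => i _.
  by rewrite (unsplitK (inl i)) scalerA.
by rewrite (unsplitK (inr i)).
Qed.

HB.instance Definition _ :=
  GRing.isSubmodClosed.Build K V lin_pred lin_submod_closed.

Lemma lin_incl (v : V) : F v -> v \in lin_pred.
Proof.
move=> Fv; apply/lin_predP; exists 1%N, (fun=> 1), (fun=> v); split=> //.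
by rewrite big_ord1 scale1r.
Qed.

Record lin : Type := Lin { lin_val :> V; lin_valP : lin_val \in lin_pred }.

HB.instance Definition _ := [isSub for lin_val].
HB.instance Definition _ := [Choice of lin by <:].
HB.instance Definition _ := [SubChoice_isSubLmodule of lin by <:].

End LinearSpan.

Section Powers.
Context (R : realType).
Implicit Types (alpha : nat -> R).

Definition power (a : R) : R -> R := fun t => t `^ a.

(* [t `^ a] is defined for all real [t]: [0 `^ 0 = 1], [0 `^ a = 0] for
   [a != 0], and the junk value [t `^ a = 1] for [t < 0].  Hence every element
   of the span satisfies [f t = f 1] for [t < 0], so that it is determined by
   its restriction to [0, +oo[: the span over the real line is the span over
   the half-line. *)
Definition powers alpha : set (R -> R) := range (fun i => power (alpha i)).

Definition linpow alpha : Type := lin (powers alpha).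

HB.instance Definition _ alpha := GRing.SubLmodule.on (linpow alpha).

Definition linpow_fun alpha (p : linpow alpha) : R -> R := lin_val p.

Coercion linpow_fun : linpow >-> Funclass.

(* A measure on [0, +oo[ is represented by a Borel measure on the real line,
   of which only the restriction to [0, +oo[ is used. *)
Definition is_moment_functional alpha (L : linpow alpha -> R) : Prop :=
  exists mu : {measure set (measurableTypeR R) -> \bar R},
    forall f : linpow alpha,
      mu.-integrable `[0, +oo[ (EFin \o f) /\
      (L f)%:E = (\int[mu]_(x in `[0%R, +oo[) (f x)%:E)%E.

(* Columns [g 0, ..., g (2m)]; row [0] belongs to the point [x], and row
   [2k+1] (values) and row [2k+2] (derivatives) belong to the point [z`_k]. *)
Definition confluent_mx (g : nat -> R -> R) m (z : m.-tuple R) (x : R) :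
    'M[R]_(m.*2.+1) :=
  \matrix_(i, j)
    if i == 0 :> nat then g j x
    else if odd i then g j z`_(i.-1./2)
    else derive1 (g j) z`_(i.-1./2).

(* The top line is [t `^ alpha k, ..., t `^ alpha (k + 2m)]. *)
Definition confluent_det alpha k m (z : m.-tuple R) : R -> R :=
  fun x => \det (confluent_mx (fun j => power (alpha (k + j)%N)) z x).

Lemma confluent_det_in_lin alpha k m (z : m.-tuple R) :
  confluent_det alpha k z \in lin_pred (powers alpha).
Proof.
pose g j := power (alpha (k + j)%N).
have -> : confluent_det alpha k z =
    \sum_(j < m.*2.+1) cofactor (confluent_mx g z 0) ord0 j *: g j.
  apply/funext => x; rewrite /confluent_det (expand_det_row _ ord0) fct_sumE.
  apply: eq_bigr => j _; rewrite mxE /= mulrC; congr (_ * _).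
  rewrite /cofactor; congr (_ * \det _).
  by apply/matrixP => a b; rewrite !mxE.
by apply: rpred_sum => j _; apply/rpredZ/lin_incl; exists (k + j)%N.
Qed.

Definition det_lin alpha k m (z : m.-tuple R) : linpow alpha :=
  Lin (confluent_det_in_lin alpha k z).

End Powers.

(* Main.v *)
Require Import Defs.
From HB Require Import structures.
From mathcomp Require Import all_boot all_order all_algebra.
From mathcomp Require Import all_classical all_reals all_analysis.
From mathcomp Require Import measurable_realfun ring lra zify.
Import Order.TTheory GRing.Theory Num.Theory.
Import numFieldNormedType.Exports.
Local Open Scope ring_scope.

(** Why the theorem is true.

    That a moment functional is nonnegative on nonnegative functions is clear,
    and so is the passage to strictly positive functions.  Each determinant in
    the last condition is nonnegative on the half-line, hence becomes strictly
    positive after adding a small constant, and the constant is then let tend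
    to zero.  What remains is to return from the determinants to a measure,
    in two steps.

    From determinants to all nonnegative combinations
    ([nonneg_from_determinants]).  Fix the span of the first [2m+1] powers and
    suppose [L] takes a negative value on its cone of nonnegative elements.
    Let [E] be the sum of the evaluations at [1, ..., 2m+1], which is positive
    on the nonzero elements of the cone.  By compactness [L / E] attains a
    minimum [lam < 0] at some [p] ([cone_minimizer]); then
    [kappa = L - lam E] is nonnegative on the cone and vanishes at [p].  Counting zeros
    in the manner of Descartes ([psum_zeros_lt], by Rolle's theorem), with the
    zeros of the nonnegative [p] being double, shows that [p] has so few zeros
    that one of the determinants [d] vanishes at all of them, those at [0] and
    at infinity included.  By compactness of the half-line completed at
    infinity, [d <= C p + eps (1 + x^(alpha_(2m)))] for every [eps > 0] and
    some [C] ([psum_domination]), so that [kappa d <= 0] and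
    [L d <= lam E d < 0], a contradiction.  Only the vanishing of [d] where [p]
    vanishes matters, not the orders of the zeros: this is what makes
    determinants with distinct nodes sufficient, without any passage to the
    limit of merging nodes.

    The nonnegativity of the determinants ([confluent_det_psum]) rests on the
    same zero count.  The leading coefficient is a confluent generalised
    Vandermonde determinant, positive by induction on its size
    ([hermite_det_gt0]), and a combination of [2m+1] powers having [m] double
    zeros has no other zeros and does not change sign at these
    ([psum_double_zeros_ge0]).

    From nonnegativity to a measure ([nonneg_moment_functional]).  [L] is
    extended positively to the span of the powers and the indicator functions
    of the half-lines [x > q] with [q] rational ([positive_extension]).  The
    values on these indicators, made right-continuous, form the tail function
    of a Lebesgue-Stieltjes measure ([measure_with_tail]).  Slicing a power
    [x^a] horizontally into layers of height [e] compares [L] with the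
    integral; what lies above finitely many layers is negligible because the
    next power of the family grows faster ([layer_tail_le],
    [layer_tail_ge]). *)

Set Implicit Arguments.
Unset Strict Implicit.

(** * Generalised polynomials and their positive zeros *)

Section GeneralizedPolynomials.
Context {R : realType}.
Implicit Types (b c : nat -> R) (n : nat) (x y z : R) (s t : seq R).

(** The exponents are arbitrary reals rather than nonnegative ones, so that the
    class is stable under differentiation and under division by a power; both
    are needed to iterate Rolle's theorem. *)
Definition psum b c n : R -> R := fun x => \sum_(j < n) c j * x `^ b j.

Definition dpsum b c := psum (fun j => b j - 1) (fun j => c j * b j).

Definition increasing b := forall i, b i < b i.+1.

Lemma increasing_lt b : increasing b -> {homo b : i j / (i < j)%N >-> i < j}.
Proof.
move=> hb; apply: (homo_ltn (r := fun x y : R => x < y)) => // y x z.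
exact: lt_trans.
Qed.

Lemma psum_is_derive b c n x : 0 < x -> is_derive x 1 (psum b c n) (dpsum b c n x).
Proof.
move=> x0; rewrite /psum /dpsum /psum.
have -> : (fun x => \sum_(j < n) c j * x `^ b j) =
    \sum_(j < n) (c j *: (fun x : R => x `^ b j)).
  by apply/funext => y; rewrite fct_sumE.
have H : forall j : 'I_n, is_derive x 1 (c j *: (fun x : R => x `^ b j))
    (c j * b j * x `^ (b j - 1)).
  by move=> j; rewrite -mulrA; apply: is_deriveZ; exact: is_derive1_powR.
exact: is_derive_sum.
Qed.

Lemma psum_shift b c n e x : 0 < x ->
  psum (fun j => b j + e) c n x = x `^ e * psum b c n x.
Proof.
move=> x0; rewrite /psum big_distrr /=; apply: eq_bigr => j _.
by rewrite powRD ?(gt_eqF x0) ?implybT// mulrA mulrC.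
Qed.

Lemma psum_continuous b c n x : 0 < x -> {for x, continuous (psum b c n)}.
Proof.
move=> x0; apply: differentiable_continuous; apply/derivable1_diffP.
by have [] := psum_is_derive b c n x0.
Qed.

Lemma psum_recl b c n x :
  psum b c n.+1 x = c 0%N * x `^ b 0%N + psum (b \o succn) (c \o succn) n x.
Proof. by rewrite /psum big_ord_recl. Qed.

Lemma psum_recr b c n x : psum b c n.+1 x = psum b c n x + c n * x `^ b n.
Proof. by rewrite /psum big_ord_recr. Qed.

(** Rolle's theorem in each gap of a sorted list of zeros of [f].  The flag [d]
    marks the zeros known to be double: they are zeros of [f'] besides the
    intermediate ones, and must be recovered in the list obtained. *)
Lemma Rolle_path (f f' : R -> R) (d : pred R) x s :
  (forall y, 0 < y -> is_derive y 1 f (f' y)) ->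
  0 < x -> f x = 0 -> path <%R x s -> {in s, forall y, f y = 0} ->
  {in s, forall y, d y -> f' y = 0} ->
  exists t, [/\ path <%R x t, {in t, forall y, f' y = 0},
    size t = (size s + count d s)%N & {in s, forall y, d y -> y \in t}].
Proof.
move=> df; elim: s x => [|y s IH] x x0 fx /=; first by exists [::].
case/andP => xy ys fs ds.
have y0 : 0 < y := lt_trans x0 xy.
have fy : f y = 0 by apply: fs; rewrite mem_head.
have [t [yt ft st dt]] := IH y y0 fy ys
  (fun z zs => fs z (mem_behead (s := y :: s) zs))
  (fun z zs => ds z (mem_behead (s := y :: s) zs)).
have [w wI|||w wxy dw] := @Rolle _ f x y xy.
- have xw : x < w by rewrite (itvP wI).
  by have [] := df w (lt_trans x0 xw).
- apply: derivable_within_continuous => w; rewrite in_itv /= => /andP[xw _].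
  by have [] := df w (lt_le_trans x0 xw).
- by rewrite fx fy.
have xw : x < w by rewrite (itvP wxy).
have wy : w < y by rewrite (itvP wxy).
have fw : f' w = 0.
  by have [_ <-] := df w (lt_trans x0 xw); have [_ ->] := dw.
have wt : path <%R w t by case: (t) yt => //= a t' /andP[ya ->]; rewrite (lt_trans wy).
have [dy|ndy] := boolP (d y).
  exists [:: w, y & t]; split => /=.
  - by rewrite xw wy yt.
  - move=> z; rewrite !inE => /or3P[/eqP->//|/eqP->|]; last exact: ft.
    by apply: ds => //; rewrite mem_head.
  - by rewrite st; lia.
  - move=> z; rewrite !inE => /orP[->|zs dz]; first by rewrite orbT.
    by rewrite dt // !orbT.
exists (w :: t); split => /=.
- by rewrite xw.
- by move=> z; rewrite inE => /orP[/eqP->//|]; exact: ft.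
- by rewrite st; lia.
- move=> z; rewrite !inE => /orP[/eqP->|zs dz]; first by rewrite (negbTE ndy).
  by rewrite dt // orbT.
Qed.

(** Coefficients and exponents of the derivative of [psum b c] divided by its
    lowest power: the constant term has disappeared, hence the shift of the
    indices. *)
Definition dquot_coef b c j := c j.+1 * (b j.+1 - b 0%N).
Definition dquot_exp b j := b j.+1 - b 0%N - 1.

Lemma psum_normalize b c n x : 0 < x ->
  psum (fun j => b j - b 0%N) c n x = x `^ (- b 0%N) * psum b c n x.
Proof. exact: psum_shift. Qed.

Lemma dpsum_normalize b c n x :
  dpsum (fun j => b j - b 0%N) c n.+1 x = psum (dquot_exp b) (dquot_coef b c) n x.
Proof. by rewrite /dpsum psum_recl subrr mulr0 mul0r add0r. Qed.

Lemma normalize_zero b c n x : 0 < x -> psum b c n x = 0 ->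
  psum (fun j => b j - b 0%N) c n x = 0.
Proof. by move=> x0 p0; rewrite psum_normalize// p0 mulr0. Qed.

Lemma dnormalize_zero b c n x : 0 < x -> psum b c n x = 0 -> dpsum b c n x = 0 ->
  dpsum (fun j => b j - b 0%N) c n x = 0.
Proof.
move=> x0 p0 d0.
have -> : dpsum (fun j => b j - b 0%N) c n x =
   x `^ (- b 0%N) * (dpsum b c n x - b 0%N / x * psum b c n x).
  rewrite /dpsum /psum !big_distrr /= -sumrB big_distrr; apply: eq_bigr => j _ /=.
  have -> : b j - b 0%N - 1 = - b 0%N + (b j - 1) by ring.
  rewrite (powRD (r := - b 0%N) (s := b j - 1)) ?(gt_eqF x0) ?implybT//.
  rewrite (powRB (r := b j) (s := 1)) ?(gt_eqF x0) ?implybT// powRr1 ?ltW//.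
  by field; rewrite (gt_eqF x0).
by rewrite p0 d0 mulr0 subr0 mulr0.
Qed.

Lemma path_gt0 x s : path <%R x s -> {in s, forall y, x < y}.
Proof. by rewrite path_sortedE; [case/andP => /allP|exact: lt_trans]. Qed.

(** Descartes' bound: division by the lowest power does not affect the positive
    zeros, differentiation then removes one term, and Rolle's theorem loses at
    most one zero.  The first derivative accounts for the double zeros, counted
    by the flag [d]; from then on every zero is counted once. *)
Lemma psum_zeros_lt b c n (d : pred R) s :
  increasing b -> (exists2 j, (j < n)%N & c j != 0) ->
  path <%R 0 s -> {in s, forall y, psum b c n y = 0} ->
  {in s, forall y, d y -> dpsum b c n y = 0} ->
  (size s + count d s < n)%N.
Proof.
elim: n b c d s => [|n IH] b c d s hb [j jn cj] s0 ps ds //.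
have sgt0 := path_gt0 s0.
case: s s0 ps ds sgt0 => [//|x s] /= /andP[x0 xs] ps ds sgt0.
pose h := psum (fun j => b j - b 0%N) c n.+1.
have [||| t [xt ft st dt]] := @Rolle_path h (dpsum (fun j => b j - b 0%N) c n.+1)
    d x s (@psum_is_derive _ _ _) x0 _ xs.
- by apply: normalize_zero => //; apply: ps; rewrite mem_head.
- by move=> y ys; apply: normalize_zero; [apply: sgt0|apply: ps]; rewrite inE ys orbT.
- move=> y ys dy; apply: dnormalize_zero; [apply: sgt0|apply: ps|apply: ds] => //;
    by rewrite inE ys orbT.
have [/existsP[i ci]|/existsPn nc] := boolP [exists i : 'I_n, c i.+1 != 0]; last first.
  have c0 : forall i, (i < n)%N -> c i.+1 = 0.
    by move=> i ni; apply/eqP; have := nc (Ordinal ni); rewrite negbK.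
  have : psum b c n.+1 x = 0 by apply: ps; rewrite mem_head.
  rewrite psum_recl /psum big1 ?addr0; last by move=> i _; rewrite /= c0 ?mul0r.
  move/eqP; rewrite mulf_eq0 powR_eq0 (gt_eqF x0) /= orbF => /eqP c00.
  by move: cj; case: j jn => [|j] jn; rewrite ?c00 ?c0 ?eqxx.
have nz : exists2 j, (j < n)%N & dquot_coef b c j != 0.
  exists i => //; rewrite mulf_neq0 // subr_eq0 gt_eqF //; exact: increasing_lt.
have hb' : increasing (dquot_exp b) by move=> k; rewrite !ltrD2r; exact: hb.
have path0 : path <%R 0 (if d x then x :: t else t).
  by case: (d x); rewrite /= ?x0 //; case: (t) xt => //= a t' /andP[/(lt_trans x0)->].
have := IH _ _ pred0 _ hb' nz path0.
rewrite count_pred0 addn0 => H.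
suff : (size (if d x then x :: t else t) < n)%N by case: (d x) => /=; rewrite st; lia.
apply: H => // y yt; rewrite -dpsum_normalize.
case: (boolP (d x)) yt => [dx|_]; last exact: ft.
rewrite inE => /orP[/eqP->|]; last exact: ft.
by apply: dnormalize_zero => //; [apply: ps|apply: ds]; rewrite ?mem_head.
Qed.

End GeneralizedPolynomials.

(** * Behaviour at infinity and at double zeros *)

Section Signs.
Context {R : realType}.
Implicit Types (b c : nat -> R) (n : nat) (x y z : R) (s t : seq R).

(** Applied to the ratio of two consecutive powers, this lets the next power
    absorb every contribution from a neighbourhood of infinity. *)
Lemma powR_dominates (e a K : R) : e < a ->
  exists2 X : R, 1 <= X & forall x, X <= x -> K * x `^ e <= x `^ a.
Proof.
move=> ea; have ae : 0 < a - e by rewrite subr_gt0.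
exists (Num.max 1 ((`|K| + 1) `^ (a - e)^-1)); first by rewrite le_max lexx.
move=> x; rewrite ge_max => /andP[x1 Xx].
have x0 : 0 < x by lra.
have -> : x `^ a = x `^ (a - e) * x `^ e.
  by rewrite -powRD ?(gt_eqF x0) ?implybT// subrK.
apply: ler_wpM2r; first exact: powR_ge0.
apply: (@le_trans _ _ (`|K| + 1)); first by have := ler_norm K; lra.
have K0 : 0 <= `|K| + 1 by have := normr_ge0 K; lra.
have := ge0_ler_powR (ltW ae) _ _ Xx; rewrite -powRrM mulVf ?gt_eqF//.
by rewrite powRr1//; apply; rewrite nnegrE ?powR_ge0// ltW.
Qed.

Lemma psum_dominated b c n (a eps : R) : (forall j, (j < n)%N -> b j < a) ->
  0 < eps -> exists2 X : R, 1 <= X & forall x, X <= x ->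
    `|psum b c n x| <= eps * x `^ a.
Proof.
elim: n eps => [|n IH] eps ba e0.
  by exists 1 => // x _; rewrite /psum big_ord0 normr0 mulr_ge0 ?powR_ge0// ltW.
have e2 : 0 < eps / 2 by lra.
have [X X1 HX] := IH _ (fun j jn => ba j (ltnW jn)) e2.
have [Y Y1 HY] := powR_dominates (`|c n| / (eps / 2)) (ba n (ltnSn n)).
exists (Num.max X Y) => [|x]; first by rewrite le_max X1.
rewrite ge_max => /andP[/HX h1 /HY h2]; rewrite psum_recr.
apply: (le_trans (ler_normD _ _)); rewrite [eps]splitr mulrDl; apply: lerD => //.
rewrite normrM (ger0_norm (powR_ge0 _ _)).
by rewrite mulrAC ler_pdivrMr// mulrC in h2; rewrite mulrC [leRHS]mulrC.
Qed.

Lemma psum_lead b c n : increasing b -> 0 < c n ->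
  exists2 X : R, 1 <= X & forall x, X <= x ->
    c n / 2 * x `^ b n <= psum b c n.+1 x.
Proof.
move=> hb cn; have c2 : 0 < c n / 2 by lra.
have [X X1 HX] := psum_dominated (b := b) c (n := n) (a := b n)
  (fun j => @increasing_lt _ b hb j n) c2.
exists X => // x /HX; rewrite psum_recr ler_norml => /andP[h _].
by rewrite [c n in leRHS]splitr mulrDl; lra.
Qed.

Lemma psum_within_continuous b c n (u v : R) : 0 < u ->
  {within `[u, v], continuous (psum b c n)}%classic.
Proof.
move=> u0; apply: derivable_within_continuous => w; rewrite in_itv /= => /andP[uw _].
by have [] := psum_is_derive b c n (lt_le_trans u0 uw).
Qed.

Lemma psum_gt0_after b c n y : increasing b -> 0 < c n -> 0 <= y ->
  (forall x, y < x -> psum b c n.+1 x != 0) ->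
  forall x, y < x -> 0 < psum b c n.+1 x.
Proof.
move=> hb cn y0 nz x yx; rewrite ltNge; apply/negP => px.
have [X X1 HX] := psum_lead hb cn.
pose v := Num.max X x.
have pv : 0 < psum b c n.+1 v.
  have Xv : X <= v by rewrite le_max lexx.
  apply: lt_le_trans (HX _ Xv); rewrite mulr_gt0 ?divr_gt0// powR_gt0//.
  by apply: lt_le_trans Xv; lra.
have [] := @IVT _ (psum b c n.+1) x v 0.
- by rewrite le_max lexx orbT.
- by apply: psum_within_continuous; lra.
- by rewrite ge_min px le_max (ltW pv) orbT.
move=> w; rewrite in_itv /= => /andP[xw _] pw0.
by have := nz w (lt_le_trans yx xw); rewrite pw0 eqxx.
Qed.

Lemma psum_zeros_lt_uniq b c n (d : pred R) s :
  increasing b -> (exists2 j, (j < n)%N & c j != 0) ->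
  uniq s -> {in s, forall y, 0 < y} -> {in s, forall y, psum b c n y = 0} ->
  {in s, forall y, d y -> dpsum b c n y = 0} ->
  (size s + count d s < n)%N.
Proof.
move=> hb nz us s0 ps ds.
have memE := mem_sort <=%R s.
have := @psum_zeros_lt _ b c n d (sort <=%R s) hb nz.
rewrite size_sort count_sort; apply.
- rewrite path_sortedE; last exact: lt_trans.
  rewrite lt_sorted_uniq_le sort_uniq us sort_le_sorted !andbT.
  by apply/allP => y; rewrite memE; exact: s0.
- by move=> y; rewrite memE; exact: ps.
- by move=> y; rewrite memE; exact: ds.
Qed.

(** Second derivative test at a double zero.  The conclusion is weak on purpose:
    multiplication by [sigma] treats both signs at once. *)
Lemma second_derivative_test (f f' : R -> R) y sigma :
  0 < y -> (forall x, 0 < x -> is_derive x 1 f (f' x)) ->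
  f y = 0 -> f' y = 0 -> is_derive y 1 f' sigma -> sigma != 0 ->
  exists2 del : R, 0 < del <= y & forall x, `|x - y| < del -> 0 <= sigma * f x.
Proof.
move=> y0 df fy f'y ds s0.
have : ((h^-1 *: (f' (h *: 1 + y) - f' y)) @[h --> 0^'] --> sigma)%classic.
  by have [D1 <-] := ds; exact: D1.
have ns : 0 < `|sigma| by rewrite normr_gt0.
move=> /cvgr_dist_lt /(_ _ ns) [e /= e0 He].
exists (Num.min e y) => [|x]; first by rewrite lt_min e0 y0 ge_min lexx orbT.
have key w : w != y -> `|w - y| < e -> 0 < sigma * (f' w / (w - y)).
  move=> wy we; have wy0 : w - y != 0 by rewrite subr_eq0.
  have /= := He (w - y); rewrite sub0r normrN => /(_ we wy0).
  rewrite /GRing.scale /= mulr1 subrK f'y subr0 [(w - y)^-1 * _]mulrC.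
  move: (f' w / (w - y)) => q; rewrite ltr_norml.
  case: (ltrgtP 0 sigma) s0 => // s0 _; [rewrite gtr0_norm//|rewrite ltr0_norm//] => /andP[q1 q2].
    by apply: mulr_gt0 => //; lra.
  by rewrite nmulr_rgt0//; lra.
rewrite lt_min => /andP[xe xy].
have x0 : 0 < x by move: xy; rewrite ltr_norml => /andP[]; lra.
have cf u v : 0 < u -> {within `[u, v], continuous f}%classic.
  move=> u0; apply: derivable_within_continuous => w; rewrite in_itv /= => /andP[uw _].
  by have [] := df w (lt_le_trans u0 uw).
have key2 w : `|w - y| < e -> 0 <= sigma * f' w * (w - y).
  have [->|wy /(key _ wy)] := eqVneq w y; first by rewrite subrr mulr0.
  have w2 : 0 < (w - y) ^+ 2 by rewrite exprn_even_gt0//= subr_eq0.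
  have -> : sigma * f' w * (w - y) = sigma * (f' w / (w - y)) * (w - y) ^+ 2.
    by field; rewrite subr_eq0.
  by move=> h; rewrite ltW// mulr_gt0.
move: xe; rewrite ltr_norml => /andP[a1 a2].
case: (ltrgtP x y) => [xly|ylx|->]; last by rewrite fy mulr0.
- have [w|w wI fE] := @MVT _ f f' x y xly _ (cf x y x0).
    by rewrite in_itv /= => /andP[xw _]; apply: df; lra.
  have [xw wy] : x < w /\ w < y by rewrite !(itvP wI).
  rewrite fy sub0r in fE.
  have H : 0 <= sigma * f' w * (w - y).
    by apply: key2; rewrite ltr_norml; apply/andP; split; lra.
  have : sigma * f' w <= 0 by rewrite -(nmulr_lge0 _ (x := w - y))//; lra.
  have -> : f x = - (f' w * (y - x)) by rewrite -fE opprK.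
  by rewrite mulrN mulrA oppr_ge0 => h; rewrite mulr_le0_ge0//; lra.
- have [w|w wI fE] := @MVT _ f f' y x ylx _ (cf y x y0).
    by rewrite in_itv /= => /andP[xw _]; apply: df; lra.
  have [yw wx] : y < w /\ w < x by rewrite !(itvP wI).
  rewrite fy subr0 in fE.
  have H : 0 <= sigma * f' w * (w - y).
    by apply: key2; rewrite ltr_norml; apply/andP; split; lra.
  rewrite fE mulrA; apply: mulr_ge0; last lra.
  by rewrite -(pmulr_lge0 _ (x := w - y))//; lra.
Qed.

(** The derivative [q] of the combination divided by its lowest power already
    has its maximal number [2m-1] of positive zeros: the [m] double zeros and
    one point between any two neighbours.  So these zeros are simple, and the
    second derivative test applies. *)
Lemma psum_double_zero_local_sign b c m s y :
  increasing b -> 0 < c m.*2 -> size s = m -> path <%R 0 s ->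
  {in s, forall y, psum b c m.*2.+1 y = 0} ->
  {in s, forall y, dpsum b c m.*2.+1 y = 0} -> y \in s ->
  exists sigma del : R, [/\ sigma != 0, 0 < del <= y &
    forall x, `|x - y| < del -> 0 <= sigma * psum b c m.*2.+1 x].
Proof.
move=> hb cm ss s0 ps ds ys.
have sgt0 := path_gt0 s0.
have y0 := sgt0 y ys.
set n := m.*2.
pose h := psum (fun j => b j - b 0%N) c n.+1.
pose q := psum (dquot_exp b) (dquot_coef b c) n.
pose sigma := dpsum (dquot_exp b) (dquot_coef b c) n y.
have hz x : x \in s -> h x = 0.
  by move=> xs; apply: normalize_zero; [exact: sgt0|exact: ps].
have qz x : x \in s -> q x = 0.
  move=> xs; rewrite /q -dpsum_normalize; apply: dnormalize_zero;
  by [exact: sgt0|exact: ps|exact: ds].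
have dh x : 0 < x -> is_derive x 1 h (q x).
  by move=> x0; rewrite /q -dpsum_normalize; exact: psum_is_derive.
have sig0 : sigma != 0.
  apply/eqP => sig0.
  case: s ss s0 ps ds ys sgt0 hz qz => [//|x s] /= ss /andP[x0 xs] _ _ ys _ hz qz.
  have [||| t [xt ft st dt]] := Rolle_path (d := predT) dh x0 _ xs.
  - by apply: hz; rewrite mem_head.
  - by move=> z zs; apply: hz; rewrite inE zs orbT.
  - by move=> z zs _; apply: qz; rewrite inE zs orbT.
  have [ut xnt] : uniq t /\ x \notin t.
    by have := lt_sorted_uniq_le (x :: t); rewrite /= xt => /esym/andP[/andP[]].
  have yt : y \in x :: t.
    by move: ys; rewrite !inE => /orP[->//|/dt ->//]; rewrite orbT.
  have cy : (0 < count (pred1 y) (x :: t))%N by rewrite -has_count has_pred1.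
  move: cy => /= cy.
  suff : (size (x :: t) + count (pred1 y) (x :: t) < n)%N.
    by rewrite /= st count_predT /n -ss /=; lia.
  apply: (@psum_zeros_lt _ (dquot_exp b) (dquot_coef b c)) => //=.
  - by move=> k; rewrite !ltrD2r; exact: hb.
  - exists n.-1; rewrite /n -ss ?doubleS //=.
    move: cm; rewrite -ss /= doubleS /dquot_coef => cm.
    rewrite mulf_neq0 ?(gt_eqF cm)// subr_eq0 gt_eqF//; exact: increasing_lt.
  - by rewrite x0.
  - by move=> z; rewrite inE => /orP[/eqP->|/ft//]; apply: qz; rewrite mem_head.
  - by move=> z _ /eqP ->.
have [del del0 H] := second_derivative_test y0 dh (hz y ys) (qz y ys)
  (psum_is_derive (dquot_exp b) (dquot_coef b c) n y0) sig0.
exists sigma, del; split => // x xd.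
have x0 : 0 < x.
  by move: xd del0; rewrite ltr_norml => /andP[? ?] /andP[? ?]; lra.
by have := H x xd; rewrite /h psum_normalize// mulrCA pmulr_rge0// powR_gt0.
Qed.

End Signs.

(** * Nonnegativity from double zeros *)

Section Nonneg.
Context {R : realType}.
Implicit Types (b c : nat -> R) (n : nat) (x y z : R) (s t : seq R).

(** Otherwise [n] equidistant points of the interval would be zeros. *)
Lemma psum_nonzero_in b c n (u v : R) : increasing b ->
  (exists2 j, (j < n)%N & c j != 0) -> 0 <= u -> u < v ->
  exists2 x, u < x < v & psum b c n x != 0.
Proof.
move=> hb nz u0 uv.
pose pt (k : nat) := u + (v - u) * (k.+1%:R / n.+1%:R).
have n0 : 0 < n.+1%:R :> R by rewrite ltr0n.
have ptI k : (k < n)%N -> u < pt k < v.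
  move=> kn; rewrite /pt ltrDl mulr_gt0 ?divr_gt0 ?subr_gt0//=.
  rewrite addrC -ltrBrDr gtr_pMr ?subr_gt0// ltr_pdivrMr// mul1r ltr_nat; lia.
have pt_inj : injective pt.
  have vu0 : v - u != 0 by rewrite subr_eq0 gt_eqF.
  move=> i j; rewrite /pt => /addrI /(mulfI vu0).
  move/(mulIf (invr_neq0 (lt0r_neq0 n0))) => /eqP.
  by rewrite eqr_nat => /eqP [].
apply: contrapT => H.
have := @psum_zeros_lt_uniq _ b c n pred0 (mkseq pt n) hb nz.
rewrite size_mkseq count_pred0 addn0 ltnn => H'; suff : false by []; apply: H' => //.
- by rewrite map_inj_uniq ?iota_uniq.
- move=> y /mapP[k]; rewrite mem_iota => /andP[_ kn] ->.
  by have /andP[h _] := ptI k kn; lra.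
- move=> y /mapP[k]; rewrite mem_iota => /andP[_ kn] ->.
  by apply/eqP/negPn/negP => h; apply: H; exists (pt k) => //; exact: ptI.
Qed.

(** The [m] double zeros exhaust the [2m] zeros allowed. *)
Lemma double_zeros_complete b c m s y : increasing b -> 0 < c m.*2 ->
  size s = m -> path <%R 0 s ->
  {in s, forall y, psum b c m.*2.+1 y = 0} ->
  {in s, forall y, dpsum b c m.*2.+1 y = 0} ->
  0 < y -> psum b c m.*2.+1 y = 0 -> y \in s.
Proof.
move=> hb cm ss s0 ps ds y0 py; apply/negPn/negP => ys.
have sgt0 := path_gt0 s0.
have us : uniq s.
  by have := lt_sorted_uniq_le s; rewrite (path_sorted s0) => /esym/andP[].
have := @psum_zeros_lt_uniq _ b c m.*2.+1 (mem s) (y :: s) hb.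
have -> : count (mem s) (y :: s) = size s.
  by rewrite /= (negbTE ys) add0n; apply/eqP; rewrite -all_count; apply/allP.
rewrite /= ss -addnn addSn ltnn => H'; suff : false by []; apply: H' => //.
- by exists m.*2; rewrite ?gt_eqF // addnn.
- by rewrite ys.
- by move=> z; rewrite inE => /orP[/eqP->|/sgt0].
- by rewrite addnn => z; rewrite inE => /orP[/eqP->|/ps].
- by rewrite addnn => z _; apply: ds.
Qed.

(** Starting from a negative value, consider the supremum of the points up to
    which the combination stays nonpositive; the search is bounded because the
    combination is positive far away.  Near this supremum the sign is constant, and either sign is
    contradictory: nonpositive values would move the supremum further, and
    nonnegative ones would force an interval of zeros. *)
Lemma psum_double_zeros_ge0 b c m s x : increasing b -> 0 < c m.*2 ->
  size s = m -> path <%R 0 s ->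
  {in s, forall y, psum b c m.*2.+1 y = 0} ->
  {in s, forall y, dpsum b c m.*2.+1 y = 0} ->
  0 < x -> 0 <= psum b c m.*2.+1 x.
Proof.
move=> hb cm ss s0 ps ds.
set P := psum b c m.*2.+1.
have nzc : exists2 j, (j < m.*2.+1)%N & c j != 0 by exists m.*2; rewrite ?gt_eqF.
have loc y : 0 < y -> exists2 del : R, 0 < del <= y &
    (forall x, `|x - y| < del -> 0 <= P x) \/ (forall x, `|x - y| < del -> P x <= 0).
  move=> y0; have [py|py] := eqVneq (P y) 0.
    have [sig [del [sig0 del0 H]]] := psum_double_zero_local_sign hb cm ss s0 ps ds
      (double_zeros_complete hb cm ss s0 ps ds y0 py).
    exists del => //; case: (ltrgtP 0 sig) sig0 => // sig0 _; [left|right] => w /H.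
      by rewrite pmulr_rge0.
    by rewrite nmulr_rge0.
  have := @psum_continuous _ b c m.*2.+1 y y0.
  move=> /cvgr_dist_lt /(_ `|P y|); rewrite normr_gt0 => /(_ py) [e /= e0 He].
  exists (Num.min e y); first by rewrite lt_min e0 y0 ge_min lexx orbT.
  have {}He w : `|w - y| < Num.min e y -> `|P y - P w| < `|P y|.
    by rewrite lt_min => /andP[we _]; apply: He; rewrite /= distrC.
  case: (ltrgtP 0 (P y)) py => // py _; [left|right] => w /He; rewrite ltr_norml.
    by rewrite gtr0_norm // => /andP[]; lra.
  by rewrite ltr0_norm // => /andP[]; lra.
move=> x0; rewrite leNgt; apply/negP => Px.
have [X X1 HX] := psum_lead hb cm.
pose v := Num.max X x + 1.
have xX : x <= Num.max X x by rewrite le_max lexx orbT.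
have XX : X <= Num.max X x by rewrite le_max lexx.
have xv : x < v by rewrite /v; lra.
have pv : 0 < P v.
  have Xv : X <= v by rewrite /v; lra.
  by apply: lt_le_trans (HX _ Xv); rewrite mulr_gt0 ?divr_gt0// powR_gt0; lra.
pose S := [set w | x <= w <= v /\ forall u, x <= u <= w -> P u <= 0]%classic.
have Sx : S x.
  split; first by rewrite lexx ltW.
  by move=> u ux; have -> : u = x; [apply/le_anti; rewrite andbC|exact: ltW].
have supS : has_sup S by split; [exists x|exists v => w [/andP[]]].
pose y := sup S.
have xy : x <= y by apply: ub_le_sup => //; case: supS.
have yv : y <= v by apply: ge_sup; [exists x|move=> w [/andP[]]].
have y0 : 0 < y by exact: lt_le_trans xy.
have [del /andP[del0 dely] [pos|neg]] := loc y y0.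
- have [w Sw yw] := sup_adherent del0 supS; rewrite -/y in yw.
  case: (Sw) => /andP[xw _] Pw.
  have wy : w <= y by apply: ub_le_sup => //; case: supS.
  have xyd : x <= y - del.
    rewrite leNgt; apply/negP => h; have := pos x.
    by rewrite ltr_norml => H; have : 0 <= P x; [apply: H; apply/andP; split; lra|lra].
  have [u /andP[yu uw] Pu] := psum_nonzero_in hb nzc (le_trans (ltW x0) xyd) yw.
  move: Pu; rewrite -/P => /eqP; apply; apply/le_anti/andP; split.
    by apply: Pw; apply/andP; split; lra.
  by apply: pos; rewrite ltr_norml; apply/andP; split; lra.
- have [w Sw yw] := sup_adherent del0 supS; rewrite -/y in yw.
  case: (Sw) => /andP[xw _] Pw.
  have vy : ~~ (v < y + del).
    apply/negP => h; have := neg v; rewrite ltr_norml => H.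
    by have : P v <= 0; [apply: H; apply/andP; split; lra|lra].
  suff : S (y + del / 2) by move=> /(ub_le_sup (proj2 supS)); rewrite -/y; lra.
  split; first by apply/andP; split; lra.
  move=> u /andP[xu uy]; case: (leP u w) => uw; first by apply: Pw; rewrite xu.
  by apply: neg; rewrite ltr_norml; apply/andP; split; lra.
Qed.

End Nonneg.

(** * Confluent generalised Vandermonde determinants *)

(** Replacing one row of a determinant by the values of the functions at a
    variable point turns it into a combination of these functions, whose
    coefficients are the cofactors of that row; it vanishes on the functionals
    of the remaining rows because two rows then agree. *)
Lemma det_expand_marked_row (K : comPzRingType) (r : nat -> nat -> K) n (i0 : 'I_n.+1) :
  exists c : nat -> K,
  [/\ forall v : nat -> K,
        \det (\matrix_(i < n.+1, j < n.+1) if i == i0 :> nat then v j else r i j) =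
        \sum_(j < n.+1) c j * v j,
      c n = (-1) ^+ (i0 + n) * \det (\matrix_(i < n, j < n) r (bump i0 i) j)
    & forall k, (k < n.+1)%N -> k != i0 -> \sum_(j < n.+1) c j * r k j = 0].
Proof.
pose A (v : nat -> K) : 'M[K]_n.+1 :=
  \matrix_(i, j) if i == i0 :> nat then v j else r i j.
pose c j := cofactor (A (fun=> 0)) i0 (inord j).
have AE v : \det (A v) = \sum_(j < n.+1) c j * v j.
  rewrite (expand_det_row _ i0); apply: eq_bigr => j _.
  rewrite mxE eqxx mulrC /c inord_val /cofactor; congr (_ * \det _ * _).
  by apply/matrixP => a b; rewrite !mxE (inj_eq val_inj) eq_sym (negbTE (neq_lift _ _)).
exists c; split => // [|k kn ki].
  rewrite /c /cofactor; have -> : inord n = @ord_max n by apply/val_inj; rewrite /= inordK.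
  congr (_ * \det _); apply/matrixP => a b; rewrite !mxE (inj_eq val_inj).
  rewrite eq_sym (negbTE (neq_lift _ _)); congr r.
  by rewrite /= /bump leqNgt ltn_ord.
rewrite -AE; apply: (determinant_alternate (i1 := Ordinal kn) (i2 := i0)) => [|j].
  by rewrite -(inj_eq val_inj).
by rewrite !mxE /= eqxx (negbTE ki).
Qed.

Section Determinants.
Context {R : realType}.
Implicit Types (b c : nat -> R) (n : nat) (x y : R) (s z : seq R).

(** Rows of the matrix of Hermite interpolation at double nodes. *)
Definition hermite_row b z i : nat -> R := fun j =>
  if odd i then derive1 (power (b j)) z`_(i./2) else power (b j) z`_(i./2).

Lemma power_derive1 (a x : R) : 0 < x -> derive1 (power a) x = a * x `^ (a - 1).
Proof. by move=> x0; rewrite powR_derive1 // in_itv /= x0. Qed.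

Lemma psum_hermite_row b c n z k : 0 < z`_k ->
  \sum_(j < n) c j * hermite_row b z k.*2 j = psum b c n z`_k /\
  \sum_(j < n) c j * hermite_row b z k.*2.+1 j = dpsum b c n z`_k.
Proof.
move=> z0; rewrite /hermite_row /= odd_double uphalf_double doubleK /=.
split=> //; rewrite /dpsum; apply: eq_bigr => j _.
by rewrite power_derive1 // mulrA.
Qed.

Lemma path_nth_gt0 z k : path <%R 0 z -> (k < size z)%N -> 0 < z`_k.
Proof. by move=> z0 kz; apply: (path_gt0 z0); rewrite mem_nth. Qed.

Lemma derive_ge0_right (f : R -> R) y d : is_derive y 1 f d -> f y = 0 ->
  (forall x, y < x -> 0 < f x) -> 0 <= d.
Proof.
move=> [D1 <-] fy fpos; have {D1} := D1; rewrite /derivable -/(derive f y 1).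
set d' := 'D_1 f y; move=> D1; rewrite leNgt; apply/negP => d0.
have : ((h^-1 *: (f (h *: 1 + y) - f y)) @[h --> 0^'] --> d')%classic by exact: D1.
have nd : 0 < - d' by lra.
move=> /cvgr_dist_lt /(_ _ nd) [e /= e0 He].
have e2 : 0 < e / 2 by lra.
have /= := He (e / 2); rewrite sub0r normrN gtr0_norm // gt_eqF //.
have -> : e / 2 < e by lra.
move=> /(_ isT isT); rewrite fy subr0 ltr_norml => /andP[+ _].
have : 0 <= (e / 2)^-1 *: f ((e / 2) *: 1 + y).
  by rewrite mulr_ge0 ?invr_ge0 ?(ltW e2) // ltW // fpos // [_%:A]mulr1 ltrDr.
by lra.
Qed.

(** By induction on the size: with its last row replaced by the values at [x],
    the determinant is a combination of powers whose leading coefficient is the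
    previous determinant, and which has the maximal number of zeros at the
    previous nodes.  So it is positive to the right of them, which settles the
    case of an evaluation row; if the last row is a derivative, at the last
    node, the combination vanishes there and its derivative is nonnegative, and
    not zero since one more zero would be too many. *)
Lemma hermite_det_gt0 b z n : increasing b -> path <%R 0 z ->
  (n <= (size z).*2)%N ->
  0 < \det (\matrix_(i < n, j < n) hermite_row b z i j).
Proof.
move=> hb z0; elim: n => [|n IH] nz; first by rewrite det_mx00.
have {}IH := IH (ltnW nz).
have [c [cE cn c0]] := det_expand_marked_row (hermite_row b z) (@ord_max n).
have {}cn : 0 < c n.
  rewrite cn addnn -signr_odd odd_double expr0 mul1r.
  set M := (X in \det X); suff -> : M = \matrix_(i < n, j < n) hermite_row b z i j by [].
  by apply/matrixP => i j; rewrite !mxE /= /bump leqNgt ltn_ord.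
have -> : \det (\matrix_(i < n.+1, j < n.+1) hermite_row b z i j) =
    \sum_(j < n.+1) c j * hermite_row b z n j.
  by rewrite -cE; congr (\det _); apply/matrixP => i j; rewrite !mxE; case: eqP => [->|].
set m := n./2; pose s := take m z.
have mz : (m < size z)%N by rewrite /m; lia.
have ss : size s = m by rewrite size_take mz.
have zm0 : 0 < z`_m by exact: path_nth_gt0.
have s_path : path <%R 0 s by move: z0; rewrite -{1}(cat_take_drop m z) cat_path => /andP[].
have sgt0 := path_gt0 s_path.
have us : uniq s by move: (lt_sorted_uniq_le s); rewrite (path_sorted s_path) => /esym/andP[].
have sz x : x \in s -> exists2 k, (k < m)%N & x = z`_k.
  move=> xs; exists (index x s); rewrite -?ss ?index_mem //.
  by rewrite -(nth_take 0 (n0 := m)) ?nth_index // -ss index_mem.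
have ps x : x \in s -> psum b c n.+1 x = 0.
  move=> /sz[k km ->]; have [<- _] := psum_hermite_row b c n.+1 (path_nth_gt0 z0 (ltn_trans km mz)).
  by rewrite /m in km; apply: c0 => /=; lia.
have dps x : x \in s -> dpsum b c n.+1 x = 0.
  move=> /sz[k km ->]; have [_ <-] := psum_hermite_row b c n.+1 (path_nth_gt0 z0 (ltn_trans km mz)).
  by rewrite /m in km; apply: c0 => /=; lia.
have slt x : x \in s -> x < z`_m.
  move=> /sz[k km ->]; apply: (sorted_ltn_nth lt_trans) => //; first exact: path_sorted z0.
  by rewrite inE (ltn_trans km).
have nzc : exists2 j, (j < n.+1)%N & c j != 0 by exists n; rewrite ?gt_eqF.
have cnt (d : pred R) l : (n.+1 <= size l + count d l)%N -> uniq l -> {in l, forall y, 0 < y} ->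
    {in l, forall y, psum b c n.+1 y = 0} -> {in l, forall y, d y -> dpsum b c n.+1 y = 0} -> False.
  by move=> hl ul l0 pl dl; have := psum_zeros_lt_uniq hb nzc ul l0 pl dl; rewrite ltnNge hl.
have [nodd|neven] := boolP (odd n).
  have nE : n = m.*2.+1 by rewrite /m; lia.
  have [pz _] := psum_hermite_row b c n.+1 zm0.
  rewrite [X in hermite_row _ _ X]nE; have [_ ->] := psum_hermite_row b c n.+1 zm0.
  have {}pz : psum b c n.+1 z`_m = 0 by rewrite -pz; apply: c0 => /=; lia.
  have ul : uniq (z`_m :: s) by rewrite /= us andbT; apply/negP => /slt; rewrite ltxx.
  have lt_s : count (mem s) s = m by rewrite -ss; apply/eqP; rewrite -all_count; apply/allP.
  have pos x : z`_m < x -> 0 < psum b c n.+1 x.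
    apply: psum_gt0_after => //; first exact: ltW.
    move=> w zw; apply/eqP => pw; apply: (cnt (mem s) [:: w, z`_m & s]).
    - by rewrite /= lt_s ss; lia.
    - rewrite cons_uniq ul andbT inE negb_or gt_eqF //=.
      by apply/negP => /slt; lra.
    - by move=> y; rewrite !inE => /or3P[/eqP->|/eqP->|/sgt0] //; lra.
    - by move=> y; rewrite !inE => /or3P[/eqP->|/eqP->|/ps].
    - by move=> y _; exact: dps.
  rewrite lt_neqAle; apply/andP; split.
    apply/eqP => d0; apply: (cnt predT (z`_m :: s)).
    - by rewrite count_predT /= ss; lia.
    - exact: ul.
    - by move=> y; rewrite !inE => /orP[/eqP->|/sgt0].
    - by move=> y; rewrite !inE => /orP[/eqP->|/ps].
    - by move=> y; rewrite !inE => /orP[/eqP-> _|/dps].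
  exact: derive_ge0_right (psum_is_derive b c n.+1 zm0) pz pos.
have nE : n = m.*2 by rewrite /m; lia.
rewrite [X in hermite_row _ _ X]nE; have [-> _] := psum_hermite_row b c n.+1 zm0.
pose y0 := (0 :: z)`_m.
have z_lt i j : (i < j <= size z)%N -> (0 :: z)`_i < (0 :: z)`_j.
  move=> /andP[ij jz]; apply: (sorted_ltn_nth lt_trans) => //.
  by rewrite inE /= ltnS // (leq_trans (ltnW ij)).
have y0_ge0 : 0 <= y0.
  rewrite /y0; case: (posnP m) => [->//|m0]; apply: ltW; apply: (z_lt 0%N); lia.
apply: (@psum_gt0_after _ b c n y0) => //; last by apply: (z_lt m m.+1); lia.
move=> w yw; apply/eqP => pw; apply: (cnt (mem s) (w :: s)).
- have -> : count (mem s) (w :: s) = (count (mem s) [:: w] + size s)%N.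
    by rewrite /= addn0; congr addn; apply/eqP; rewrite -all_count; apply/allP.
  by rewrite /= ss; lia.
- rewrite /= us andbT; apply/negP => /sz[k km wE]; have : w <= y0; last lra.
  by rewrite wE /y0; case: (ltngtP k.+1 m) km => // [km _|<- //]; apply/ltW/(z_lt k.+1); lia.
- by move=> y; rewrite !inE => /orP[/eqP->|/sgt0] //; lra.
- by move=> y; rewrite !inE => /orP[/eqP->|/ps].
- by move=> y _; exact: dps.
Qed.

End Determinants.

(** * The determinants as nonnegative combinations *)

Section Confluent.
Context {R : realType}.
Implicit Types (b c : nat -> R) (n : nat) (x y : R) (s z : seq R).
Local Open Scope classical_set_scope.

Lemma psum_cvg0 b c n : (forall j, 0 <= b j) ->
  psum b c n x @[x --> 0^'+] --> psum b c n 0.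
Proof.
move=> b0; elim: n => [|n IH].
  have -> : psum b c 0 = (fun=> 0) by apply/funext => x; rewrite /psum big_ord0.
  exact: cvg_cst.
have -> : psum b c n.+1 = (fun x => psum b c n x + c n * x `^ b n).
  by apply/funext => x; rewrite psum_recr.
have powc : x `^ b n @[x --> 0^'+] --> (0 : R) `^ b n.
  have [->|bn] := eqVneq (b n) 0.
    have -> : powR (R := R) ^~ 0 = (fun=> 1) by apply/funext => x; rewrite powRr0.
    by rewrite powRr0; exact: cvg_cst.
  by rewrite powR0 //; apply: powR_cvg0; rewrite lt_neqAle eq_sym bn b0.
exact: cvgD IH (cvgM (cvg_cst (c n)) powc).
Qed.

Lemma psum_within_continuous0 b c n (v : R) : (forall j, 0 <= b j) -> 0 < v ->
  {within `[0, v], continuous (psum b c n)}.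
Proof.
move=> b0 v0; apply/continuous_within_itvP => //; split.
- by move=> x; rewrite in_itv /= => /andP[x0 _]; exact: psum_continuous.
- exact: psum_cvg0.
- exact/cvg_at_left_filter/psum_continuous.
Qed.

Lemma psum_ge0_at0 b c n : (forall j, 0 <= b j) ->
  (forall x, 0 < x -> 0 <= psum b c n x) -> forall x, 0 <= x -> 0 <= psum b c n x.
Proof.
move=> b0 pos x; rewrite le_eqVlt => /predU1P[<-|/pos//].
rewrite -(cvg_lim _ (psum_cvg0 (c := c) (n := n) b0))//.
apply: limr_ge; first exact: (cvgP _ (psum_cvg0 (c := c) (n := n) b0)).
by near=> y; apply: pos.
Unshelve. all: by end_near. Qed.

(** Expanding the determinant along its first row exhibits it as a combination
    of [2m+1] powers with double zeros at the given points and with a leading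
    coefficient which is a confluent generalised Vandermonde determinant. *)
Lemma confluent_det_psum (alpha : nat -> R) k m (z : m.-tuple R) :
  increasing alpha -> (forall i, 0 <= alpha i) -> path <%R 0 z ->
  exists c : nat -> R,
  [/\ 0 < c m.*2,
      confluent_det alpha k z = psum (fun j => alpha (k + j)%N) c m.*2.+1,
      {in z, forall y, psum (fun j => alpha (k + j)%N) c m.*2.+1 y = 0}
    & forall x, 0 <= x -> 0 <= psum (fun j => alpha (k + j)%N) c m.*2.+1 x].
Proof.
move=> ha a0 z0; set b := fun j => alpha (k + j)%N.
have hb : increasing b by move=> j; rewrite /b addnS.
have [c [cE cn c0]] := det_expand_marked_row (fun i => hermite_row b z i.-1) (@ord0 m.*2).
have {}cn : 0 < c m.*2.
  rewrite cn add0n -signr_odd odd_double expr0 mul1r.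
  have := @hermite_det_gt0 _ b z m.*2 hb z0; rewrite size_tuple => /(_ (leqnn _)).
  set M := (X in \det X); set N := (X in _ -> 0 < \det X).
  by suff -> : N = M by []; apply/matrixP => i j; rewrite !mxE.
have zE y : y \in tval z -> exists2 i, (i < m)%N & y = z`_i.
  by move=> yz; exists (index y z); rewrite ?nth_index // -[X in (_ < X)%N](size_tuple z) index_mem.
have nthz i : (i < m)%N -> 0 < z`_i by move=> im; apply: path_nth_gt0; rewrite ?size_tuple.
have ps : {in tval z, forall y, psum b c m.*2.+1 y = 0}.
  move=> _ /zE[i im ->]; have [<- _] := psum_hermite_row b c m.*2.+1 (nthz i im).
  by apply: (c0 i.*2.+1) => //; lia.
have ds : {in tval z, forall y, dpsum b c m.*2.+1 y = 0}.
  move=> _ /zE[i im ->]; have [_ <-] := psum_hermite_row b c m.*2.+1 (nthz i im).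
  by apply: (c0 i.*2.+2) => //; lia.
exists c; split => //.
- apply/funext => x; rewrite /confluent_det; have /= := cE (fun j => x `^ b j).
  rewrite /psum => <-; congr (\det _).
  apply/matrixP => i j; rewrite !mxE /=; case: ifP => // /negbT i0.
  by rewrite /hermite_row; case: (nat_of_ord i) i0 => //= i' _; rewrite if_neg.
- apply: psum_ge0_at0 => [j|x]; first exact: a0.
  exact: psum_double_zeros_ge0 (size_tuple z) z0 ps ds.
Qed.

End Confluent.

(** * The cone of nonnegative combinations *)

Section Cone.
Context {R : realType}.
Implicit Types (b c p d l : nat -> R) (n : nat) (x y : R) (s z : seq R).
Local Open Scope classical_set_scope.

Definition nonneg_psum b n c := forall x, 0 <= x -> 0 <= psum b c n x.

Lemma psumN b c n x : psum b (fun j => - c j) n x = - psum b c n x.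
Proof. by rewrite /psum -sumrN; apply: eq_bigr => j _; rewrite mulNr. Qed.

Lemma psum_lead_ge0 b n c : increasing b -> nonneg_psum b n.+1 c -> 0 <= c n.
Proof.
move=> hb pos; rewrite leNgt; apply/negP => cn.
have cn' : 0 < - c n by lra.
have [X X1 /(_ X (lexx X))] := psum_lead (c := fun j => - c j) hb cn'.
have X0 : 0 < X by lra.
rewrite psumN; have := pos X (ltW X0).
have : 0 < - c n / 2 * X `^ b n by rewrite mulr_gt0 ?powR_gt0//; lra.
by lra.
Qed.

(** The part of the half-line, completed at infinity, where [d] exceeds
    [eps (1 + x^(b n))] is compact and [p] is positive on it.  The point at
    infinity is represented by the leading coefficients and is treated apart,
    by comparing the growth of both sides. *)
Lemma psum_domination b n p d eps : increasing b -> (forall j, 0 <= b j) ->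
  nonneg_psum b n.+1 p ->
  (forall x, 0 <= x -> psum b p n.+1 x = 0 -> psum b d n.+1 x = 0) ->
  (p n = 0 -> d n = 0) -> 0 < eps ->
  exists C : R, forall x, 0 <= x ->
    psum b d n.+1 x <= C * psum b p n.+1 x + eps * (1 + x `^ b n).
Proof.
move=> hb b0 ppos pd pdn e0.
have bn j : (j < n)%N -> b j < b n by exact: increasing_lt.
have [X [C1 [X1 C10 H1]]] : exists X C1 : R, [/\ 1 <= X, 0 <= C1 & forall x, X <= x ->
    psum b d n.+1 x <= C1 * psum b p n.+1 x + eps * x `^ b n].
  have [pn|pn] := eqVneq (p n) 0.
    have [X X1 HX] := psum_dominated d bn e0.
    exists X, 0; split => // x /HX; rewrite psum_recr pdn // mul0r addr0 mul0r add0r.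
    exact: le_trans (ler_norm _).
  have pn0 : 0 < p n by rewrite lt_neqAle eq_sym pn (psum_lead_ge0 hb ppos).
  have [X X1 HX] := psum_dominated d bn ltr01.
  have [Y Y1 HY] := psum_lead hb pn0.
  exists (Num.max X Y), (2 * (`|d n| + 1) / p n); split.
  - by rewrite le_max X1.
  - by rewrite divr_ge0 ?mulr_ge0 ?addr_ge0 // ltW.
  move=> x; rewrite ge_max => /andP[/HX h1 /HY h2].
  have xb0 : 0 <= x `^ b n by exact: powR_ge0.
  have : (2 * (`|d n| + 1) / p n) * (p n / 2 * x `^ b n) <=
      2 * (`|d n| + 1) / p n * psum b p n.+1 x.
    by apply: ler_wpM2l => //; rewrite divr_ge0 ?mulr_ge0 ?addr_ge0 // ltW.
  have -> : 2 * (`|d n| + 1) / p n * (p n / 2 * x `^ b n) =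
    `|d n| * x `^ b n + x `^ b n by field; rewrite gt_eqF.
  rewrite [psum b d _ x]psum_recr.
  have : d n * x `^ b n <= `|d n| * x `^ b n by rewrite ler_wpM2r // ler_norm.
  have : 0 <= eps * x `^ b n by rewrite mulr_ge0 // ltW.
  by move: (le_trans (ler_norm _) h1); lra.
have X0 : 0 < X by lra.
have cd := psum_within_continuous0 (c := d) (n := n.+1) b0 X0.
have cp := psum_within_continuous0 (c := p) (n := n.+1) b0 X0.
(* [g] is positive on the half-line, and equals [p] wherever [d] is at least [eps]. *)
pose g x := psum b p n.+1 x + (`|eps - psum b d n.+1 x| + (eps - psum b d n.+1 x)).
have cg : {within `[0, X], continuous g}.
  move=> x; apply: cvgD; first exact: cp.
  have ced : {for x, continuous (fun y : subspace `[0, X] => eps - psum b d n.+1 y)}.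
    by apply: cvgB; [exact: cvg_cst|exact: cd].
  by apply: cvgD => //; exact: cvg_norm.
have [xm + Hm] := EVT_min (ltW X0) cg.
rewrite in_itv /= => /andP[xm0 _].
have gm : 0 < g xm.
  rewrite /g; have := ppos xm xm0; have := ler_norm (- (eps - psum b d n.+1 xm)).
  rewrite normrN => h; rewrite le_eqVlt => /predU1P[/esym px|px]; last lra.
  by move: h; rewrite px (pd xm xm0 px) subr0 ger0_norm ?(ltW e0) //; lra.
have [xM + HM] := EVT_max (ltW X0) cd.
rewrite in_itv /= => /andP[xM0 _].
set M := psum b d n.+1 xM in HM.
exists (C1 + `|M| / g xm) => x x0.
have px := ppos x x0; have xb0 : 0 <= x `^ b n by exact: powR_ge0.
have C20 : 0 <= `|M| / g xm by rewrite divr_ge0 // ltW.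
have h1 : 0 <= C1 * psum b p n.+1 x by exact: mulr_ge0.
have h2 : 0 <= `|M| / g xm * psum b p n.+1 x by exact: mulr_ge0.
have h3 : 0 <= eps * x `^ b n by rewrite mulr_ge0 // ltW.
case: (leP X x) => [/H1|xX]; first by lra.
have xI : x \in `[0, X]%R by rewrite in_itv /= x0 ltW.
case: (leP (psum b d n.+1 x) eps) => [|dx]; first by lra.
have : g xm <= psum b p n.+1 x.
  by have := Hm x xI; rewrite [g x]/g ler0_norm; lra.
move=> /(ler_wpM2l C20); rewrite divfK ?gt_eqF //.
have := HM x xI; have := ler_norm M; lra.
Qed.

(** The points are positive and as many as the powers: a nonzero nonnegative
    combination cannot vanish at all of them. *)
Definition eval_sum b n c : R := \sum_(k < n) psum b c n k.+1%:R.

Lemma eval_sum_gt0 b n c : increasing b -> nonneg_psum b n c ->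
  (exists2 j, (j < n)%N & c j != 0) -> 0 < eval_sum b n c.
Proof.
move=> hb pos nz.
have ge0 (k : 'I_n) : true -> 0 <= psum b c n k.+1%:R by move=> _; apply: pos.
rewrite lt_neqAle sumr_ge0 // andbT eq_sym psumr_eq0 //; apply/negP => /allP H.
have := @psum_zeros_lt_uniq _ b c n pred0 (mkseq (fun k => k.+1%:R) n) hb nz.
rewrite size_mkseq count_pred0 addn0 ltnn => H'; suff : false by []; apply: H' => //.
- rewrite map_inj_uniq ?iota_uniq // => i j /eqP; rewrite eqr_nat => /eqP [].
  done.
- by move=> y /mapP[k _ ->]; rewrite ltr0n.
- move=> y /mapP[k]; rewrite mem_iota => /andP[_ kn] ->; apply/eqP.
  exact: H (Ordinal kn) (mem_index_enum _).
Qed.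

Definition pairing n l c : R := \sum_(j < n) c j * l j.

Lemma eval_sum_pairing b n c :
  eval_sum b n c = pairing n (fun j => \sum_(k < n) k.+1%:R `^ b j) c.
Proof.
rewrite /eval_sum /pairing exchange_big; apply: eq_bigr => j _ /=.
by rewrite big_distrr.
Qed.

Definition coef n (u : 'rV[R]_n.+1) (j : nat) : R := u ord0 (inord j).

Lemma pairing_coef_continuous n l :
  continuous (fun u : 'rV[R]_n.+1 => pairing n.+1 l (coef u)).
Proof.
have H N : continuous (fun u : 'rV[R]_n.+1 => \sum_(j < N) coef u j * l j).
  elim: N => [|N IH] u.
    have -> : (fun u : 'rV[R]_n.+1 => \sum_(j < 0) coef u j * l j) = fun=> 0.
      by apply/funext => w; rewrite big_ord0.
    exact: cst_continuous.
  have -> : (fun u : 'rV[R]_n.+1 => \sum_(j < N.+1) coef u j * l j) =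
      fun u => \sum_(j < N) coef u j * l j + coef u N * l N.
    by apply/funext => w; rewrite big_ord_recr.
  have c2 : {for u, continuous (fun u : 'rV[R]_n.+1 => coef u N * l N)}.
    by apply: continuousM; [exact: coord_continuous|exact: cst_continuous].
  have c1 := IH u.
  exact: continuousD c1 c2.
exact: H.
Qed.

(** The quotient of a linear functional by the sum of evaluations is homogeneous
    of degree [0], so that it is enough to minimise it over the elements of
    the cone whose coefficient vector has norm [1], a compact set. *)
Lemma cone_minimizer b n l : increasing b ->
  (exists2 c, nonneg_psum b n.+1 c & pairing n.+1 l c < 0) ->
  exists lam p, [/\ lam < 0, exists2 j, (j < n.+1)%N & p j != 0,
    nonneg_psum b n.+1 p, pairing n.+1 l p = lam * eval_sum b n.+1 p &
    forall c, nonneg_psum b n.+1 c -> lam * eval_sum b n.+1 c <= pairing n.+1 l c].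
Proof.
move=> hb [c0 c0pos c0neg].
pose S := [set u : 'rV[R]_n.+1 | `|u| = 1 /\ nonneg_psum b n.+1 (coef u)].
pose f (u : 'rV[R]_n.+1) := pairing n.+1 l (coef u) / eval_sum b n.+1 (coef u).
have normalize c : nonneg_psum b n.+1 c -> (exists2 j, (j < n.+1)%N & c j != 0) ->
    exists2 u, S u & f u = pairing n.+1 l c / eval_sum b n.+1 c.
  move=> cpos [j jn cj].
  pose r : 'rV[R]_n.+1 := \row_i c i.
  have r0 : `|r| != 0.
    rewrite normr_eq0; apply: contra cj => /eqP/rowP/(_ (Ordinal jn)).
    by rewrite !mxE /= => ->.
  have rgt0 : 0 < `|r| by rewrite lt_neqAle eq_sym r0 normr_ge0.
  have cE (v : nat -> R) : pairing n.+1 v (coef (`|r|^-1 *: r)) = `|r|^-1 * pairing n.+1 v c.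
    rewrite /pairing big_distrr; apply: eq_bigr => i _ /=.
    by rewrite /coef !mxE inord_val mulrA.
  exists (`|r|^-1 *: r); last first.
    by rewrite /f !eval_sum_pairing !cE -mulf_div divff ?mul1r // invr_eq0.
  split; first by rewrite normrZ ger0_norm ?invr_ge0 // mulVf.
  move=> x x0; rewrite -[psum _ _ _ _]/(pairing n.+1 (fun j => x `^ b j) _) cE.
  by rewrite mulr_ge0 ?invr_ge0 //; exact: cpos.
have pairing0 v c : ~ (exists2 j, (j < n.+1)%N & c j != 0) -> pairing n.+1 v c = 0.
  move=> H; rewrite /pairing big1 // => j _; apply/eqP; rewrite mulf_eq0.
  by apply/orP; left; apply/negPn/negP => cj; apply: H; exists j.
have nz0 : exists2 j, (j < n.+1)%N & c0 j != 0.
  by apply: contrapT => /(pairing0 l) h; move: c0neg; rewrite h ltxx.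
have [u0 Su0 fu0] := normalize c0 c0pos nz0.
have Snz u : S u -> exists2 j, (j < n.+1)%N & coef u j != 0.
  move=> [u1 _]; apply: contrapT => H.
  suff u00 : u = 0 by move: u1; rewrite u00 normr0 => /eqP; rewrite eq_sym oner_eq0.
  apply/rowP => i; rewrite mxE; apply/eqP/negPn/negP => ui; apply: H; exists i => //.
  by rewrite /coef inord_val.
have Epos u : S u -> 0 < eval_sum b n.+1 (coef u).
  by move=> Su; apply: eval_sum_gt0 => //; [case: Su|exact: Snz].
have cptS : compact S.
  apply: bounded_closed_compact.
    exists 1; split => // M M1 u [u1 _].
    by have h : `|u| <= M by rewrite u1 ltW.
  have -> : S = (fun u : 'rV[R]_n.+1 => `|u|) @^-1` [set 1] `&`
     \bigcap_(x in [set x : R | 0 <= x])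
       ((fun u => pairing n.+1 (fun j => x `^ b j) (coef u)) @^-1` [set y | 0 <= y]).
    by apply/seteqP; split.
  apply: closedI.
    by apply: preimage_closed => [u _|]; [exact: norm_continuous|exact: closed_eq].
  apply: closed_bigI => x _; apply: preimage_closed; last exact: closed_ge.
  by move=> u _; exact: pairing_coef_continuous.
have cf : {within S, continuous f}.
  apply: continuous_in_subspaceT => u /set_mem Su.
  have cE : {for u, continuous (fun u : 'rV[R]_n.+1 => eval_sum b n.+1 (coef u))}.
    have -> : (fun u : 'rV[R]_n.+1 => eval_sum b n.+1 (coef u)) =
        fun u => pairing n.+1 (fun j => \sum_(k < n.+1) k.+1%:R `^ b j) (coef u).
      by apply/funext => w; rewrite eval_sum_pairing.
    exact: pairing_coef_continuous.
  have Eu : eval_sum b n.+1 (coef u) != 0 by rewrite gt_eqF // Epos.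
  exact: (continuousM (@pairing_coef_continuous n l u) (continuousV Eu cE)).
have S0 : S !=set0 by exists u0.
have [us /set_mem Sus Hus] := EVT_min_rV S0 cptS cf.
exists (f us), (coef us); split.
- apply: le_lt_trans (Hus u0 (mem_set Su0)) _; rewrite fu0 ltr_pdivrMr ?mul0r //.
  exact: eval_sum_gt0.
- exact: Snz.
- by case: Sus.
- by rewrite /f divfK // gt_eqF // Epos.
move=> c cpos; have [nz|z] := pselect (exists2 j, (j < n.+1)%N & c j != 0); last first.
  by rewrite eval_sum_pairing !pairing0 // mulr0.
have [u Su fu] := normalize c cpos nz.
by rewrite -ler_pdivlMr ?eval_sum_gt0 // -fu; apply: Hus; exact: mem_set.
Qed.

End Cone.

(** * Nonnegativity from determinants *)

Section NonnegFromDeterminants.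
Context {R : realType}.
Implicit Types (b c p d l alpha : nat -> R) (n : nat) (x y : R) (s z : seq R).

Lemma pairing_lin n l p d w (A B : R) :
  pairing n l (fun j => A * p j + B * w j - d j) =
  A * pairing n l p + B * pairing n l w - pairing n l d.
Proof.
rewrite /pairing !big_distrr /= -big_split -sumrB; apply: eq_bigr => j _ /=.
by ring.
Qed.

(** The functional [kappa], equal to [l] minus [lam] times the sum of evaluations,
    is nonnegative on the cone and vanishes at the minimiser [p].  Since
    [C p + eps w - d] lies in the cone, [kappa d <= eps kappa w] for every
    [eps], that is [kappa d <= 0]; the evaluations of [d] then contribute a
    strictly negative term. *)
Lemma minimizer_forces_negative b n l lam p d :
  increasing b -> (forall j, 0 <= b j) -> b 0%N = 0 ->
  lam < 0 -> nonneg_psum b n.+1 p ->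
  pairing n.+1 l p = lam * eval_sum b n.+1 p ->
  (forall c, nonneg_psum b n.+1 c -> lam * eval_sum b n.+1 c <= pairing n.+1 l c) ->
  nonneg_psum b n.+1 d -> (exists2 j, (j < n.+1)%N & d j != 0) ->
  (forall x, 0 <= x -> psum b p n.+1 x = 0 -> psum b d n.+1 x = 0) ->
  (p n = 0 -> d n = 0) ->
  pairing n.+1 l d < 0.
Proof.
move=> hb b0 b00 lam0 ppos pE min dpos dnz pd pdn.
pose kappa c := pairing n.+1 l c - lam * eval_sum b n.+1 c.
pose w j : R := (j == 0%N)%:R + (j == n)%:R.
have wE x : psum b w n.+1 x = 1 + x `^ b n.
  rewrite /psum (eq_bigr (fun j : 'I_n.+1 => (if j == ord0 then x `^ b j else 0) +
     (if j == ord_max then x `^ b j else 0))); last first.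
    move=> j _; rewrite /w mulrDl -!(inj_eq val_inj) /=.
    by congr (_ + _); case: eqP => _; rewrite ?mul1r ?mul0r.
  by rewrite big_split /= -!big_mkcond !big_pred1_eq /= b00 powRr0.
have kd eps : 0 < eps -> kappa d <= eps * kappa w.
  move=> e0; have [C HC] := psum_domination hb b0 ppos pd pdn e0.
  have := min (fun j => C * p j + eps * w j - d j).
  rewrite {2}/kappa /kappa !eval_sum_pairing !pairing_lin pE -!eval_sum_pairing => H.
  suff : nonneg_psum b n.+1 (fun j => C * p j + eps * w j - d j) by move=> /H; nra.
  move=> x /HC; rewrite -wE.
  rewrite -[X in _ -> 0 <= X]/(pairing n.+1 (fun j => x `^ b j) _) pairing_lin.
  by rewrite /psum -/(pairing n.+1 (fun j => x `^ b j) _); rewrite subr_ge0.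
have kd0 : kappa d <= 0.
  rewrite leNgt; apply/negP => kpos; have kw := kd 1 ltr01.
  have kw0 : 0 < kappa w by lra.
  have := kd (kappa d / (2 * kappa w)); rewrite divr_gt0 ?mulr_gt0 // => /(_ isT).
  have -> : kappa d / (2 * kappa w) * kappa w = kappa d / 2 by field; rewrite gt_eqF.
  by lra.
have Ed := eval_sum_gt0 hb dpos dnz.
have : lam * eval_sum b n.+1 d < 0 by rewrite nmulr_rlt0.
by move: kd0; rewrite /kappa; lra.
Qed.

(** A positive zero of a nonnegative function is a local minimum, hence counts
    twice. *)
Lemma nonneg_zeros_size b c n s : increasing b ->
  (exists2 j, (j < n)%N & c j != 0) ->
  (forall x, 0 < x -> 0 <= psum b c n x) -> path <%R 0 s ->
  {in s, forall y, psum b c n y = 0} -> ((size s).*2 < n)%N.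
Proof.
move=> hb nz pos s0 ps.
have sgt0 := path_gt0 s0.
have := psum_zeros_lt (d := predT) hb nz s0 ps; rewrite count_predT addnn; apply.
move=> y ys _; have y0 := sgt0 y ys; have y1 : 0 <= y + 1 by lra.
have [|||_ <-] := @derive1_at_min _ (psum b c n) 0 (y + 1) y y1.
- by move=> t; rewrite in_itv /= => /andP[t0 _]; have [] := psum_is_derive b c n t0.
- by rewrite in_itv /= y0 ltrDl ltr01.
- by move=> t; rewrite in_itv /= => /andP[t0 _]; rewrite ps //; exact: pos.
by have [_ ->] := psum_is_derive b c n y0.
Qed.

(** A list of zeros of maximal length is complete. *)
Lemma positive_zeros_list b c n : increasing b ->
  (exists2 j, (j < n)%N & c j != 0) ->
  exists s, [/\ path <%R 0 s, {in s, forall y, psum b c n y = 0} &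
    forall y, 0 < y -> psum b c n y = 0 -> y \in s].
Proof.
move=> hb nz.
pose P k := `[< exists s, [/\ path <%R 0 s, {in s, forall y, psum b c n y = 0} & size s = k] >].
have P0 : exists k, P k by exists 0%N; apply/asboolP; exists [::].
have Pn k : P k -> (k <= n)%N.
  move=> /asboolP[s [s0 ps <-]]; have := psum_zeros_lt (d := pred0) hb nz s0 ps.
  by rewrite count_pred0 addn0 => H; apply: ltnW; exact: H.
case: (ex_maxnP P0 Pn) => k /asboolP[s [s0 ps sk]] kmax.
exists s; split => // y y0 py; apply/negPn/negP => ys.
suff /kmax : P k.+1 by rewrite ltnn.
apply/asboolP; exists (sort <=%R (y :: s)); split.
- rewrite path_sortedE; last exact: lt_trans.
  rewrite lt_sorted_uniq_le sort_uniq sort_le_sorted /= ys.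
  have := lt_sorted_uniq_le s; rewrite (path_sorted s0) => /esym/andP[-> _].
  rewrite !andbT; apply/allP => w; rewrite mem_sort inE => /orP[/eqP->//|].
  exact: path_gt0.
- by move=> w; rewrite mem_sort inE => /orP[/eqP->//|]; exact: ps.
- by rewrite size_sort /= sk.
Qed.

Lemma extend_path s m : path <%R 0 s -> (size s <= m)%N ->
  exists z : m.-tuple R, path <%R 0 z /\ {subset s <= z}.
Proof.
move=> s0 sm; suff [z [z0 sz zm]] :
    exists z, [/\ path <%R 0 z, {subset s <= z} & size z = m].
  by exists (Tuple (introT eqP zm)).
elim: m sm => [|m IH].
  by rewrite leqn0 size_eq0 => /eqP ->; exists [::].
rewrite leq_eqVlt => /predU1P[sm|/IH[z [z0 sz zm]]]; first by exists s; split => // y ys.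
exists (rcons z (last 0 z + 1)); split.
- by rewrite rcons_path z0 ltrDl ltr01.
- by move=> y /sz; rewrite mem_rcons inE orbC => ->.
- by rewrite size_rcons zm.
Qed.

Definition embed_coef k N c (i : nat) : R :=
  if (k <= i < k + N)%N then c (i - k)%N else 0.

Lemma psum_embed alpha k N c n x : (k + N <= n)%N ->
  psum (fun j => alpha (k + j)%N) c N x = psum alpha (embed_coef k N c) n x.
Proof.
move=> kn; rewrite /psum -(big_mkord xpredT (fun i => embed_coef k N c i * x `^ alpha i)).
have kn' : (k <= n)%N by lia.
rewrite (big_cat_nat (leq0n k) kn') /= (big_cat_nat (leq_addr N k) kn) /=.
rewrite [X in _ = X + _]big_nat [X in _ = X + _]big1 ?add0r; last first.
  by move=> i ik; rewrite /embed_coef ifF ?mul0r //; lia.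
rewrite [X in _ = _ + X]big_nat [X in _ = _ + X]big1 ?addr0; last first.
  by move=> i ik; rewrite /embed_coef ifF ?mul0r //; lia.
rewrite -[X in \sum_(X <= _ < _) _]add0n big_addn addKn big_mkord.
apply: eq_bigr => i _.
by rewrite /embed_coef addnK leq_addl [(i + k)%N]addnC ltn_add2l ltn_ord.
Qed.

Variable alpha : nat -> R.

Definition monom i : linpow alpha :=
  Lin (lin_incl (imageT (fun i => power (alpha i)) i)).

Definition comb c n : linpow alpha := \sum_(j < n) c j *: monom j.

Lemma linpowD : {morph @linpow_fun R alpha : p q / p + q}.
Proof. by []. Qed.

Lemma linpow0 : linpow_fun (0 : linpow alpha) = 0.
Proof. by []. Qed.

Lemma combE c n : comb c n = psum alpha c n :> (R -> R).
Proof.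
by apply/funext => x; rewrite /comb (big_morph _ linpowD linpow0) fct_sumE.
Qed.

Lemma linpow_eq (p q : linpow alpha) : p = q :> (R -> R) -> p = q.
Proof. by move=> pq; apply: val_inj. Qed.

Lemma linpow_comb (p : linpow alpha) :
  exists N, forall n, (N <= n)%N -> exists c, p = comb c n.
Proof.
have /lin_predP[m [c [u [Fu pE]]]] := lin_valP p.
suff [N HN] : exists N, forall n, (N <= n)%N ->
    exists d, \sum_(i < m) c i *: u i = psum alpha d n.
  exists N => n /HN[d dE]; exists d; apply: linpow_eq.
  by rewrite combE -dE -pE.
elim: m c u Fu {pE} => [|m IH] c u Fu.
  exists 0%N => n _; exists (fun=> 0); rewrite big_ord0; apply/funext => x.
  by rewrite /psum big1 // => j _; rewrite mul0r.
have [N HN] := IH (fun i => c (lift ord0 i)) (fun i => u (lift ord0 i)) (fun i => Fu _).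
have [k _ uk] := Fu ord0.
exists (maxn N k.+1) => n; rewrite geq_max => /andP[/HN[d dE] kn].
exists (fun j => (if j == k then c ord0 else 0) + d j).
rewrite big_ord_recl dE -uk; apply/funext => x.
rewrite /psum (eq_bigr (fun j : 'I_n => (if j == Ordinal kn then c ord0 * x `^ alpha j else 0) +
     d j * x `^ alpha j)); last first.
  by move=> j _; rewrite mulrDl -(inj_eq val_inj) /=; case: eqP => _; rewrite ?mul0r.
by rewrite big_split /= -big_mkcond big_pred1_eq.
Qed.

Variable L : {linear linpow alpha -> R}.

Lemma L_comb c n : L (comb c n) = pairing n (fun j => L (monom j)) c.
Proof. by rewrite linear_sum; apply: eq_bigr => j _; rewrite linearZ. Qed.

Hypothesis alpha_ge0 : forall i, 0 <= alpha i.
Hypothesis alpha0 : alpha 0%N = 0.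
Hypothesis alpha_lt : forall i, alpha i < alpha i.+1.

Lemma psum_at0 c n : psum alpha c n.+1 0 = c 0%N.
Proof.
rewrite psum_recl alpha0 powRr0 mulr1 /psum big1 ?addr0 // => j _ /=.
by rewrite powR0 ?mulr0 // gt_eqF // (le_lt_trans (alpha_ge0 j)).
Qed.

Lemma det_lin_comb k m (z : m.-tuple R) n : path <%R 0 z -> (k + m.*2.+1 <= n)%N ->
  exists c, [/\ det_lin alpha k z = comb c n, nonneg_psum alpha n c,
   exists2 j, (j < n)%N & c j != 0, {in z, forall y, psum alpha c n y = 0} &
   forall i, ~~ (k <= i < k + m.*2.+1)%N -> c i = 0].
Proof.
move=> z0 kn; have [c [cm cE cz cpos]] := confluent_det_psum k alpha_lt alpha_ge0 z0.
have E x := psum_embed alpha c x kn.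
exists (embed_coef k m.*2.+1 c); split.
- by apply: linpow_eq; rewrite combE -[LHS]/(confluent_det alpha k z) cE; apply/funext.
- by move=> x /cpos; rewrite E.
- exists (k + m.*2)%N; first by lia.
  by rewrite /embed_coef ifT ?addKn ?gt_eqF //; lia.
- by move=> y /cz; rewrite E.
- by move=> i /negbTE ik; rewrite /embed_coef ik.
Qed.

(** The minimiser [q] lives in the span of the first [2m+1] powers.  It has at
    most [m] positive zeros, and at most [m-1] if it also vanishes at [0] or at
    infinity, since it is then a combination of [2m] powers only.  In these
    cases a determinant with [m-1] nodes is used: it only involves powers of
    index at most [2m-1], so that it vanishes at infinity, and the one starting
    at the power of index [1] vanishes at [0] too. *)
Lemma nonneg_from_determinants :
  (forall m (z : m.-tuple R), path <%R 0 z -> 0 <= L (det_lin alpha 0 z)) ->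
  (forall m (z : m.-tuple R), path <%R 0 z -> 0 <= L (det_lin alpha 1 z)) ->
  forall p : linpow alpha, (forall x, 0 <= x -> 0 <= p x) -> 0 <= L p.
Proof.
move=> L0 L1 p ppos; rewrite leNgt; apply/negP => Lp.
have [N HN] := linpow_comb p.
pose m := N.+1; pose n := m.*2.
have [c pc] := HN n.+1 (ltac:(rewrite /n /m; lia)).
rewrite {}pc in ppos Lp.
have cpos : nonneg_psum alpha n.+1 c by move=> x /ppos; rewrite combE.
rewrite L_comb in Lp; set l := fun j => L (monom j) in Lp.
have [lam [q [lam0 qnz qpos qE qmin]]] :=
  cone_minimizer (l := l) alpha_lt (ex_intro2 _ _ c cpos Lp).
have [s [s0 sz zs]] := positive_zeros_list alpha_lt qnz.
have contra_det k m' : (k + m'.*2.+1 <= n.+1)%N -> (size s <= m')%N ->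
    (forall z : m'.-tuple R, path <%R 0 z -> 0 <= L (det_lin alpha k z)) ->
    (q 0%N = 0 -> (0 < k)%N) -> (q n = 0 -> (k + m'.*2.+1 <= n)%N) -> False.
  move=> kn sm' Lk q0 qn; have [z [z0 sz']] := extend_path s0 sm'.
  have [d [dE dpos dnz dz d0]] := det_lin_comb z0 kn.
  have := Lk z z0; rewrite dE L_comb leNgt => /negP; apply.
  apply: (@minimizer_forces_negative alpha n l lam q d) => //.
    move=> x; rewrite le_eqVlt => /predU1P[<-|x0].
      by rewrite !psum_at0 => /q0 k0; apply: d0; lia.
    by move=> /(zs _ x0)/sz'; exact: dz.
  by move=> /qn nk; apply: d0; lia.
have pos' x : 0 < x -> 0 <= psum alpha q n.+1 x by move=> /ltW; exact: qpos.
have [q0|q0] := eqVneq (q 0%N) 0.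
  have E x : psum alpha q n.+1 x = psum (alpha \o succn) (q \o succn) n x.
    by rewrite psum_recl q0 mul0r add0r.
  apply: (contra_det 1%N N _ _ (L1 N)) => //; try by rewrite /n /m; lia.
  suff : ((size s).*2 < n)%N by rewrite /n /m; lia.
  apply: (@nonneg_zeros_size (alpha \o succn) (q \o succn)) => //.
  - by move=> i /=.
  - by case: qnz => [[|j]]; rewrite ?q0 ?eqxx // ltnS => jn qj; exists j.
  - by move=> x /pos'; rewrite E.
  - by move=> y /sz; rewrite E.
have [qn|qn] := eqVneq (q n) 0.
  have E x : psum alpha q n.+1 x = psum alpha q n x.
    by rewrite psum_recr qn mul0r addr0.
  apply: (contra_det 0%N N _ _ (L0 N)) => //; try by rewrite /n /m; lia.
  - suff : ((size s).*2 < n)%N by rewrite /n /m; lia.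
    apply: (@nonneg_zeros_size alpha q) => //.
    + by exists 0%N => //; rewrite /n /m; lia.
    + by move=> x /pos'; rewrite E.
    + by move=> y /sz; rewrite E.
  - by move=> q00; rewrite q00 eqxx in q0.
apply: (contra_det 0%N m _ _ (L0 m)) => //.
- have := nonneg_zeros_size alpha_lt qnz pos' s0 sz; rewrite /n; lia.
- by move=> q00; rewrite q00 eqxx in q0.
- by move=> qn0; rewrite qn0 eqxx in qn.
Qed.

End NonnegFromDeterminants.

(** * Positive extension to countably many functions *)

Section Extension.
Context {R : realType} (alpha : nat -> R) (L : {linear linpow alpha -> R}).
Hypothesis L_ge0 : forall p : linpow alpha, (forall x, 0 <= x -> 0 <= p x) -> 0 <= L p.
Variable u : nat -> R -> R.
Hypothesis u_dominated :
  forall k, exists p : linpow alpha, forall x, 0 <= x -> `|u k x| <= p x.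

Definition positive_upto n (g : nat -> R) := forall (p : linpow alpha) (c : nat -> R),
  (forall x, 0 <= x -> 0 <= p x + \sum_(k < n) c k * u k x) ->
  0 <= L p + \sum_(k < n) c k * g k.

(** One step of the extension theorem of M. Riesz: positivity bounds the value at
    [u n] from above by the elements of [A], and from below by minus the values
    in [Alow]; these bounds are compatible because [g] is positive so far, and
    the infimum of [A] is a possible choice. *)
Lemma positive_step n g : positive_upto n g ->
  exists t, positive_upto n.+1 (fun k => if k == n then t else g k).
Proof.
move=> gpos.
pose A := [set y | exists (p : linpow alpha) (c : nat -> R),
   (forall x, 0 <= x -> u n x <= p x + \sum_(k < n) c k * u k x) /\
   y = L p + \sum_(k < n) c k * g k]%classic.
have [p0 Hp0] := u_dominated n.
have A0 : A !=set0%classic.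
  exists (L p0 + \sum_(k < n) 0 * g k), p0, (fun=> 0); split => // x /Hp0.
  by rewrite big1 ?addr0 => [|k _]; [exact: le_trans (ler_norm _)|rewrite mul0r].
(* Any lower estimate of [u n] bounds [A] from below. *)
have Alow (p : linpow alpha) (c : nat -> R) :
    (forall x, 0 <= x -> 0 <= p x + \sum_(k < n) c k * u k x + u n x) ->
    lbound A (- (L p + \sum_(k < n) c k * g k)).
  move=> H _ [p' [c' [H' ->]]].
  have E (v : nat -> R) : \sum_(k < n) (c k + c' k) * v k =
      \sum_(k < n) c k * v k + \sum_(k < n) c' k * v k.
    by rewrite -big_split; apply: eq_bigr => k _; rewrite mulrDl.
  have pos := gpos (p + p') (fun k => c k + c' k); rewrite linearD (E g) in pos.
  suff : 0 <= L p + L p' + (\sum_(k < n) c k * g k + \sum_(k < n) c' k * g k) by lra.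
  apply: pos => x x0; rewrite (E (u ^~ x)) linpowD -[(_ + _) x]/(p x + p' x).
  by have := H x x0; have := H' x x0; lra.
have hasinf : has_inf A.
  split => //; eexists; apply: (Alow p0 (fun=> 0)) => x x0.
  rewrite big1 ?addr0 => [|k _]; last by rewrite mul0r.
  by have := Hp0 x x0; rewrite ler_norml => /andP[]; lra.
exists (inf A) => p c H.
have E (v : nat -> R) t : \sum_(k < n.+1) c k * (if k == n :> nat then t else v k) =
    \sum_(k < n) c k * v k + c n * t.
  rewrite big_ord_recr /= eqxx; congr (_ + _); apply: eq_bigr => k _.
  by rewrite ltn_eqF.
rewrite E; have {}H x : 0 <= x -> 0 <= p x + \sum_(k < n) c k * u k x + c n * u n x.
  by move=> /H; rewrite big_ord_recr /= addrA.
have sc a (v : nat -> R) : \sum_(k < n) (a * c k) * v k = a * \sum_(k < n) c k * v k.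
  by rewrite big_distrr; apply: eq_bigr => k _ /=; rewrite mulrA.
have := normr_ge0 (c n); case: (ltrgtP (c n) 0) => [cn|cn|cn] _; last first.
- rewrite cn mul0r addr0; apply: gpos => x /H.
  by rewrite cn mul0r addr0.
- have [cn0 ci0] : c n != 0 /\ 0 < (c n)^-1 by rewrite gt_eqF ?invr_gt0.
  have Hl : - (L ((c n)^-1 *: p) + \sum_(k < n) ((c n)^-1 * c k) * g k) <= inf A.
    apply: lb_le_inf => //; apply: (Alow _ (fun k => (c n)^-1 * c k)) => x /H h.
    rewrite (sc _ (u ^~ x)).
    rewrite -[(_ *: p : linpow alpha) x]/((c n)^-1 * p x) -mulrDr.
    have := mulr_ge0 (ltW ci0) h; congr (_ <= _).
    by move: (\sum_(k < n) _) => S; field.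
  move: Hl; rewrite sc linearZ /= -[_ *: _]/(_ * _) -mulrDr -mulrN ler_pdivrMl //.
  by lra.
- have [cn0 ci0] : c n != 0 /\ 0 < - (c n)^-1 by rewrite lt_eqF // oppr_gt0 invr_lt0.
  have Hu : inf A <= L (- (c n)^-1 *: p) + \sum_(k < n) (- (c n)^-1 * c k) * g k.
    apply: ge_inf; first by case: hasinf.
    exists (- (c n)^-1 *: p), (fun k => - (c n)^-1 * c k); split => // x /H h.
    rewrite (sc _ (u ^~ x)).
    rewrite -[(_ *: p : linpow alpha) x]/(- (c n)^-1 * p x) -mulrDr.
    rewrite -subr_ge0; have := mulr_ge0 (ltW ci0) h; congr (_ <= _).
    by move: (\sum_(k < n) _) => S; field.
  move: Hu; rewrite sc linearZ /= -[_ *: _]/(_ * _) -mulrDr -invrN.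
  by rewrite mulrC ler_pdivlMr ?oppr_gt0 //; lra.
Qed.

Lemma positive_extension : exists g : nat -> R, forall n, positive_upto n g.
Proof.
have step n (G : {g | positive_upto n g}) :
    {t | positive_upto n.+1 (fun k => if k == n then t else sval G k)}.
  by apply: cid; apply: positive_step; exact: (svalP G).
have base : positive_upto 0 (fun=> 0).
  move=> p c H; rewrite big_ord0 addr0; apply: L_ge0 => x /H.
  by rewrite big_ord0 addr0.
pose fix G n : {g | positive_upto n g} :=
  if n is n'.+1 then
    exist (positive_upto n'.+1)
      (fun k => if k == n' then sval (step n' (G n')) else sval (G n') k)
      (svalP (step n' (G n')))
  else exist (positive_upto 0) (fun=> 0) base.
exists (fun k => sval (G k.+1) k) => n.
have stable m k : (k < m)%N -> sval (G m) k = sval (G k.+1) k.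
  elim: m => // m IH; rewrite ltnS leq_eqVlt => /predU1P[->//|km].
  by rewrite -IH //= ltn_eqF.
move=> p c /(svalP (G n) p c); congr (_ <= _ + _).
by apply: eq_bigr => k _; rewrite stable.
Qed.

End Extension.

(** * Measures with a given tail function *)

Section Tails.
Context {R : realType}.
Local Open Scope classical_set_scope.

Variable H : R -> R.
Hypothesis H_nonincr : {homo H : x y / x <= y >-> y <= x}.
Hypothesis H_rcont : forall t e, 0 < e -> exists2 s, t < s & H t - e < H s.
Hypothesis H_lim : forall e, 0 < e -> exists T, H T < e.
Hypothesis H_ge0 : forall t, 0 <= H t.

Lemma tail_small e : 0 < e -> exists T, forall t, T <= t -> `|H t| < e.
Proof.
move=> /H_lim[T HT]; exists T => t Tt; rewrite ger0_norm //.
exact: le_lt_trans (H_nonincr Tt) HT.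
Qed.

(** The Lebesgue-Stieltjes measure of [- H] gives the mass [H t - H T] to
    [`]t, T]]; let [T] tend to infinity. *)
Lemma measure_with_tail :
  exists mu : {measure set (measurableTypeR R) -> \bar R},
    forall t, mu `]t, +oo[ = (H t)%:E.
Proof.
pose F t := - H t.
have Fnd : nondecreasing F by move=> x y xy; rewrite lerN2; exact: H_nonincr.
have Frc : right_continuous F.
  move=> t; apply/cvgrPdist_lt => e e0.
  have [s ts Hs] := H_rcont t e0.
  near=> w.
  have tw : t <= w by near: w; exact: nbhs_right_ge.
  have ws : w <= s by near: w; exact: nbhs_right_le.
  rewrite /F opprK addrC ltr_norml.
  have := H_nonincr tw; have := H_nonincr ws.
  by move=> h1 h2; apply/andP; split; lra.
pose F' : cumulative R R := HB.pack F (isCumulative.Build R _ R F Fnd Frc).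
pose mu : {measure set (measurableTypeR R) -> \bar R} := lebesgue_stieltjes_measure F'.
exists mu => t.
pose I n : set R := `]t, t + n%:R].
have IE n : mu (I n) = (H t - H (t + n%:R))%:E.
  rewrite /mu /= /lebesgue_stieltjes_measure /measure_extension.
  rewrite measurable_mu_extE /=; last exact: is_ocitv.
  by rewrite wlength_itv_bnd ?lerDl // /F' /= /F opprK addrC.
have c1 : mu \o I @ \oo --> mu (\bigcup_n I n).
  apply: nondecreasing_cvg_mu => //.
  - by move=> n; exact: measurable_itv.
  - by apply: bigcup_measurable => n _; exact: measurable_itv.
  - move=> m n mn; apply/subsetPset/subset_itv; rewrite // bnd_simp.
    by rewrite lerD2l ler_nat.
have c2 : mu \o I @ \oo --> (H t)%:E.
  have -> : mu \o I = EFin \o (fun n => H t - H (t + n%:R)) by apply/funext => n /=; exact: IE.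
  apply: cvg_EFin; first by near=> n.
  have c3 : (fun n => H t - H (t + n%:R)) @ \oo --> H t - 0.
    apply: cvgB; first exact: cvg_cst.
    apply/cvgrPdist_lt => e /tail_small[T HT].
    near=> n; rewrite sub0r normrN; apply: HT.
    by rewrite -lerBlDl; near: n; exact: nbhs_infty_ger.
  by rewrite subr0 in c3.
by rewrite itv_bndy_bigcup_BRight; apply: cvg_unique c1 c2.
Unshelve. all: by end_near. Qed.

(** The mass of the closed half-line is the limit of the masses of the open
    ones starting slightly below [0], where [H] is constant. *)
Lemma tail_measure_ge0 (mu : {measure set (measurableTypeR R) -> \bar R}) :
  (forall t, mu `]t, +oo[ = (H t)%:E) -> (forall t, t < 0 -> H t = H (-1)) ->
  mu `[0, +oo[ = (H (-1))%:E.
Proof.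
move=> muE Hneg.
pose I n : set R := `]- n.+1%:R^-1, +oo[.
have IE n : mu (I n) = (H (-1))%:E by rewrite /I muE Hneg // oppr_lt0 invr_gt0.
have bI : \bigcap_n I n = `[0, +oo[.
  apply/seteqP; split => x; rewrite /= in_itv /= andbT; last first.
    move=> x0 n _; suff : x \in `]- n.+1%:R^-1, +oo[%R by [].
    rewrite in_itv /= andbT; apply: lt_le_trans x0.
    by rewrite oppr_lt0 invr_gt0.
  move=> Hx; rewrite leNgt; apply/negP => /ltr_add_invr[k hk].
  have : x \in `]- k.+1%:R^-1, +oo[%R := Hx k Logic.I.
  by rewrite in_itv /= andbT => hx; move: hk hx; move: (k.+1%:R^-1) => a; lra.
have c1 : mu \o I @ \oo --> mu (\bigcap_n I n).
  apply: nonincreasing_cvg_mu => //.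
  - by rewrite IE ltry.
  - by move=> n; exact: measurable_itv.
  - by apply: bigcap_measurable => // n _; exact: measurable_itv.
  - move=> m n mn; apply/subsetPset/subset_itv; rewrite // bnd_simp.
    by rewrite lerN2 lef_pV2 ?posrE // ler_nat.
have c2 : mu \o I @ \oo --> (H (-1))%:E.
  by have -> : mu \o I = fun=> (H (-1))%:E; [apply/funext|exact: cvg_cst].
by rewrite -bI; apply: cvg_unique c1 c2.
Qed.

End Tails.

(** * Values of the functional on half-lines *)

Section Layers.
Context {R : realType}.
Implicit Types (e x y a : R).

Definition layer_sum M e y : R := \sum_(j < M) e * (j.+1%:R * e < y)%R%:R.

Lemma layer_sum_full M e y : 0 <= e -> M%:R * e < y -> layer_sum M e y = M%:R * e.
Proof.
move=> e0 My; rewrite /layer_sum (eq_bigr (fun=> e)) => [|j _].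
  by rewrite sumr_const card_ord mulr_natl.
rewrite (le_lt_trans _ My) ?mulr1 // ler_wpM2r // ler_nat; exact: ltn_ord.
Qed.

Lemma layer_sum_le M e y : 0 <= e -> 0 <= y -> layer_sum M e y <= y.
Proof.
move=> e0 y0; elim: M => [|M IH]; first by rewrite /layer_sum big_ord0.
have [My|My] := ltP (M.+1%:R * e) y; first by rewrite layer_sum_full // ltW.
by rewrite /layer_sum big_ord_recr /= ltNge My mulr0 addr0.
Qed.

Lemma layer_sum_ge M e y : 0 <= e -> y <= M.+1%:R * e -> y <= layer_sum M e y + e.
Proof.
move=> e0; elim: M => [|M IH]; first by rewrite /layer_sum big_ord0 mul1r add0r.
have [My|My _] := ltP (M.+1%:R * e) y.
  by rewrite layer_sum_full // -[M.+2]addn1 natrD mulrDl mul1r.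
rewrite /layer_sum big_ord_recr /= ltNge My mulr0 addr0; exact: IH.
Qed.

Lemma powR_root_lt c x a : 0 < a -> 0 <= c -> 0 <= x ->
  (c `^ a^-1 < x) = (c < x `^ a).
Proof.
move=> a0 c0 x0.
have cE : c = (c `^ a^-1) `^ a by rewrite -powRrM mulVf ?gt_eqF // powRr1.
have r0 : 0 <= c `^ a^-1 by exact: powR_ge0.
apply/idP/idP => [h|].
  by rewrite cE; apply: gt0_ltr_powR; rewrite ?nnegrE.
apply: contraTT; rewrite -!leNgt => h.
by rewrite [leRHS]cE; apply: ge0_ler_powR; rewrite ?nnegrE // ltW.
Qed.

(** The default value only repeats the rational number [0]; all that matters is
    that every rational number occurs. *)
Definition rat_nth (k : nat) : R :=
  if @unpickle rat k is Some r then ratr r else 0.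

Lemma rat_nth_dense x y : x < y -> exists k, x < rat_nth k < y.
Proof.
move=> /rat_in_itvoo[r]; rewrite in_itv /= => rxy.
by exists (pickle r); rewrite /rat_nth pickleK.
Qed.

Definition step_fun k x : R := (rat_nth k < x)%R%:R.

End Layers.

Section TailValues.
Context {R : realType} (alpha : nat -> R) (L : {linear linpow alpha -> R}).
Hypothesis alpha_ge0 : forall i, 0 <= alpha i.
Hypothesis alpha0 : alpha 0%N = 0.
Hypothesis alpha_lt : forall i, alpha i < alpha i.+1.
Hypothesis L_ge0 : forall p : linpow alpha, (forall x, 0 <= x -> 0 <= p x) -> 0 <= L p.
Variable g : nat -> R.
Hypothesis g_positive : forall n, positive_upto L step_fun n g.

Let mass := L (monom alpha 0).

Lemma monomE i x : monom alpha i x = x `^ alpha i.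
Proof. by []. Qed.

Lemma monom0E x : monom alpha 0 x = 1.
Proof. by rewrite monomE alpha0 powRr0. Qed.

Lemma positive_seq (K : seq (R * nat)) (p : linpow alpha) :
  (forall x, 0 <= x -> 0 <= p x + \sum_(t <- K) t.1 * step_fun t.2 x) ->
  0 <= L p + \sum_(t <- K) t.1 * g t.2.
Proof.
suff [n [c H]] : exists n (c : nat -> R), forall v : nat -> R,
    \sum_(t <- K) t.1 * v t.2 = \sum_(k < n) c k * v k.
  move=> pos; rewrite H; apply: g_positive => x /pos.
  by rewrite (H (step_fun ^~ x)).
elim: K => [|[a i] K [n [c IH]]]; first by exists 0%N, (fun=> 0) => v; rewrite big_nil big_ord0.
pose N := maxn n i.+1.
have iN : (i < N)%N by rewrite leq_maxr.
exists N, (fun k => (if k == i then a else 0) + (if (k < n)%N then c k else 0)) => v.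
rewrite big_cons IH /= (eq_bigr (fun k : 'I_N => (if k == Ordinal iN then a * v k else 0) +
    (if (k < n)%N then c k * v k else 0))); last first.
  by move=> k _; rewrite mulrDl -(inj_eq val_inj) /=; do 2!case: ifP => _; rewrite ?mul0r.
rewrite big_split /= -big_mkcond big_pred1_eq; congr (_ + _).
by rewrite -big_mkcond (big_ord_widen _ (fun k => c k * v k) (leq_maxl n i.+1)).
Qed.

Lemma step_value_le (p : linpow alpha) a k :
  (forall x, 0 <= x -> a * step_fun k x <= p x) -> a * g k <= L p.
Proof.
move=> H; have := @positive_seq [:: (- a, k)] p; rewrite !big_seq1 /= mulNr subr_ge0.
by apply=> x x0; rewrite big_seq1 /= mulNr subr_ge0; exact: H.
Qed.

Lemma step_fun_ge0 k (x : R) : 0 <= step_fun k x.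
Proof. exact: ler0n. Qed.

Lemma step_value_ge0 k : 0 <= g k.
Proof.
have := @positive_seq [:: (1, k)] 0; rewrite big_seq1 /= linear0 add0r mul1r.
by apply=> x x0; rewrite big_seq1 /= mul1r add0r step_fun_ge0.
Qed.

Lemma step_value_le_mass k : g k <= mass.
Proof.
rewrite -[g k]mul1r; apply: step_value_le => x _.
by rewrite mul1r monom0E /step_fun; case: (_ < _).
Qed.

Lemma step_value_neg k : rat_nth k < (0 : R) -> g k = mass.
Proof.
move=> k0; apply/le_anti; rewrite step_value_le_mass /= -subr_ge0.
have := @positive_seq [:: (1, k)] ((-1) *: monom alpha 0).
rewrite big_seq1 /= mul1r linearZ /= -[_ *: L _]/(-1 * mass) => H.
suff : 0 <= -1 * mass + g k by lra.
apply: H => x x0.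
rewrite big_seq1 /= mul1r /step_fun (lt_le_trans k0 x0).
rewrite [X in X + _](_ : _ = -1) ?addNr //.
by rewrite -[LHS]/(-1 * monom alpha 0 x) monom0E mulr1.
Qed.

(** Right-continuous regularisation of the values of the extended functional on
    the indicators of the half-lines [x > q] with [q] rational. *)
Definition tail (t : R) : R := sup [set g k | k in [set k | (t < @rat_nth R k)%R]]%classic.

Lemma tail_has_sup t : has_sup [set g k | k in [set k | (t < @rat_nth R k)%R]]%classic.
Proof.
split; last by exists mass => _ [k _ <-]; exact: step_value_le_mass.
have tt : t < t + 1 by lra.
by have [k /andP[tk _]] := rat_nth_dense tt; exists (g k), k.
Qed.

Lemma step_value_le_tail t k : t < rat_nth k -> g k <= tail t.
Proof. by move=> tk; apply: ub_le_sup; [case: (tail_has_sup t)|exists k]. Qed.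

Lemma tail_approx t e : 0 < e -> exists2 k, t < rat_nth k & tail t - e < g k.
Proof. by move=> e0; have [_ [k tk <-] h] := sup_adherent e0 (tail_has_sup t); exists k. Qed.

Lemma tail_le t a : (forall k, t < rat_nth k -> g k <= a) -> tail t <= a.
Proof. by move=> H; apply: ge_sup => [|_ [k tk <-]]; [case: (tail_has_sup t)|exact: H]. Qed.

Lemma tail_ge0 t : 0 <= tail t.
Proof.
have [k tk _] := tail_approx t (@ltr01 R).
exact: le_trans (step_value_ge0 k) (step_value_le_tail tk).
Qed.

Lemma tail_nonincr : {homo tail : x y / x <= y >-> y <= x}.
Proof.
move=> x y xy; apply: tail_le => k yk; apply: step_value_le_tail.
exact: le_lt_trans yk.
Qed.

Lemma tail_rcont t e : 0 < e -> exists2 s, t < s & tail t - e < tail s.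
Proof.
move=> /(tail_approx t)[k tk h]; exists ((t + rat_nth k) / 2); first by lra.
by apply: lt_le_trans h _; apply: step_value_le_tail; lra.
Qed.

Lemma tail_neg t : t < 0 -> tail t = mass.
Proof.
move=> t0; apply/le_anti/andP; split; first by apply: tail_le => k _; exact: step_value_le_mass.
have [k /andP[tk k0]] := rat_nth_dense t0.
by rewrite -(step_value_neg k0); exact: step_value_le_tail.
Qed.

(** On [x > X] the constant [1] is dominated by a small multiple of the next
    power [x^(alpha 1)]. *)
Lemma tail_lim e : 0 < e -> exists T, tail T < e.
Proof.
move=> e0; have a1 : 0 < alpha 1 by rewrite -alpha0.
pose K := L (monom alpha 1).
have K0 : 0 <= K by apply: L_ge0 => x _; rewrite monomE powR_ge0.
have [X X1 HX] := powR_dominates (2 * (K + 1) / e) a1.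
have X0 : 0 < X by lra.
exists X; apply: (@le_lt_trans _ _ (e / 2)); last by lra.
apply: tail_le => k Xk.
have : (2 * (K + 1) / e) * g k <= K.
  apply: step_value_le => x x0; rewrite monomE /step_fun.
  case: ltP => kx /=; last by rewrite mulr0 powR_ge0.
  by rewrite mulr1; have := HX x; rewrite powRr0 mulr1; apply; lra.
have -> : 2 * (K + 1) / e * g k = (K + 1) * (g k / (e / 2)) by field; rewrite gt_eqF.
move=> h; rewrite -[e / 2]mul1r -ler_pdivrMr; last by lra.
have h0 : 0 <= g k / (e / 2) by rewrite divr_ge0 ?step_value_ge0 //; lra.
nra.
Qed.

Variable i : nat.
Hypothesis i0 : (0 < i)%N.
Let a := alpha i.

Lemma exponent_gt0 : 0 < a.
Proof. by rewrite -alpha0; exact: increasing_lt. Qed.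

Definition level (e : R) j : R := (j%:R * e) `^ a^-1.

Lemma level_lt e j x : 0 <= e -> 0 <= x -> (level e j < x) = (j%:R * e < x `^ a).
Proof. by move=> e0 x0; rewrite powR_root_lt ?exponent_gt0 // mulr_ge0. Qed.

(** The layers [1_(x^a > j e)] with [j = 1, ..., M], times [e], add up to at
    most [x^a].  Rational thresholds slightly above the levels realise the
    values of [tail] up to a total loss of [eta]. *)
Lemma layer_tail_le M e : 0 < e ->
  \sum_(j < M) e * tail (level e j.+1) <= L (monom alpha i).
Proof.
move=> e0; apply/ler_addgt0Pr => eta eta0.
pose d := eta / (M.+1%:R * e).
have Me0 : 0 < M.+1%:R * e by rewrite mulr_gt0 ?ltr0n.
have d0 : 0 < d by rewrite divr_gt0.
pose k j := sval (cid2 (tail_approx (level e j.+1) d0)).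
have k1 j : level e j.+1 < rat_nth (k j) by rewrite /k; case: cid2.
have k2 j : tail (level e j.+1) - d < g (k j) by rewrite /k; case: cid2.
have key : \sum_(j < M) e * g (k j) <= L (monom alpha i).
  have := @positive_seq [seq (- e, k j) | j <- index_iota 0 M] (monom alpha i).
  have E v : \sum_(t <- [seq (- e, k j) | j <- index_iota 0 M]) t.1 * v t.2 =
      - \sum_(j < M) e * v (k j) :> R.
    by rewrite big_map /= big_mkord -sumrN; apply: eq_bigr => j _; rewrite mulNr.
  rewrite E subr_ge0; apply=> x x0; rewrite (E (step_fun ^~ x)) subr_ge0 monomE.
  apply: le_trans (layer_sum_le M (ltW e0) (powR_ge0 x a)).
  apply: ler_sum => j _; apply: ler_wpM2l; first exact: ltW.
  rewrite /step_fun -level_lt ?(ltW e0) //.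
  by case: ltP => // h; rewrite (lt_trans (k1 j) h).
apply: le_trans (_ : \sum_(j < M) (e * g (k j) + e * d) <= _).
  by apply: ler_sum => j _; rewrite -mulrDr ler_wpM2l ?(ltW e0) //; have := k2 j; lra.
rewrite big_split /= sumr_const card_ord; apply: lerD key _.
rewrite -mulr_natl mulrA /d mulrCA ger_pMr // ler_pdivrMr // mul1r.
by rewrite ler_wpM2r ?(ltW e0) // ler_nat.
Qed.

(** Conversely [x^a] is at most [e] plus the sum of [M+1] layers, except above
    them, where it is at most [delta] times the next power.  The rational
    thresholds now lie between two consecutive levels; this shifts the sum by
    one layer and costs another [e] times the mass. *)
Lemma layer_tail_ge e delta : 0 < e -> 0 < delta -> exists M0, forall M, (M0 <= M)%N ->
  L (monom alpha i) <= \sum_(j < M) e * tail (level e j.+1) +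
    2 * e * mass + delta * L (monom alpha i.+1).
Proof.
move=> e0 d0; have [X X1 HX] := powR_dominates (delta^-1) (alpha_lt i).
have X0 : 0 <= X by lra.
pose M0 := Num.truncn (X `^ a / e).
have HM0 M x : (M0 <= M)%N -> 0 <= x -> M.+1%:R * e <= x `^ a -> X <= x.
  move=> M0M x0 Mx; rewrite leNgt; apply/negP => xX.
  have h1 : x `^ a < X `^ a by apply: gt0_ltr_powR; rewrite ?nnegrE ?exponent_gt0.
  have h2 : X `^ a / e < M.+1%:R.
    apply: lt_le_trans (truncnS_gt _) _; rewrite ?ler_nat //.
  by move: h2; rewrite ltr_pdivrMr //; lra.
exists M0 => M M0M.
have lev_lt j : level e j < level e j.+1.
  by rewrite level_lt ?powR_ge0 ?(ltW e0) // /level -powRrM mulVf ?gt_eqF ?exponent_gt0 //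
    powRr1 ?mulr_ge0 ?(ltW e0) // ltr_pM2r // ltr_nat.
pose k j := sval (cid (rat_nth_dense (lev_lt j))).
have kP j : level e j < rat_nth (k j) < level e j.+1 by rewrite /k; case: cid.
have key : L (monom alpha i) <= e * mass + delta * L (monom alpha i.+1) +
    \sum_(j < M.+1) e * g (k j).
  have := @positive_seq [seq (e, k j) | j <- index_iota 0 M.+1]
    (e *: monom alpha 0 + (delta *: monom alpha i.+1 + (-1) *: monom alpha i)).
  have E v : \sum_(t <- [seq (e, k j) | j <- index_iota 0 M.+1]) t.1 * v t.2 =
      \sum_(j < M.+1) e * v (k j) :> R.
    by rewrite big_map /= big_mkord.
  rewrite E !linearD !linearZ /= -!/(_ * _) => H.
  suff : 0 <= e * L (monom alpha 0) + (delta * L (monom alpha i.+1) + -1 * L (monom alpha i)) +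
      \sum_(j < M.+1) e * g (k j) by rewrite /mass; lra.
  apply: H => x x0; rewrite (E (step_fun ^~ x)).
  rewrite [X in X + _](_ : _ = e * monom alpha 0 x +
    (delta * monom alpha i.+1 x + -1 * monom alpha i x)) //.
  rewrite monom0E !monomE mulr1 -/a.
  have S1 : layer_sum M.+1 e (x `^ a) <= \sum_(j < M.+1) e * step_fun (k j) x.
    apply: ler_sum => j _; apply: ler_wpM2l; first exact: ltW.
    rewrite -level_lt ?(ltW e0) // /step_fun; have /andP[_ kj] := kP j.
    by case: ltP => // h; rewrite (lt_trans kj h).
  have [h|h] := leP (x `^ a) (M.+2%:R * e).
    have := layer_sum_ge (ltW e0) h; have := powR_ge0 x (alpha i.+1) => h2.
    have : 0 <= delta * x `^ alpha i.+1 by rewrite mulr_ge0 // ltW.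
    by lra.
  have Xx : X <= x by apply: (HM0 M.+1) => //; [exact: leqW|exact: ltW].
  have := HX x Xx; rewrite ler_pdivrMl // => h3.
  have : 0 <= \sum_(j < M.+1) e * step_fun (k j) x.
    by apply: sumr_ge0 => j _; rewrite mulr_ge0 ?(ltW e0) // step_fun_ge0.
  by rewrite -/a in h3; lra.
apply: (le_trans key); rewrite big_ord_recl /=.
have h0 : e * g (k 0%N) <= e * mass by rewrite ler_wpM2l ?(ltW e0) // step_value_le_mass.
have : \sum_(j < M) e * g (k (bump 0 j)) <= \sum_(j < M) e * tail (level e j.+1).
  apply: ler_sum => j _; rewrite ler_wpM2l ?(ltW e0) // /bump /= add1n.
  by apply: step_value_le_tail; have /andP[] := kP j.+1.
by lra.
Qed.

End TailValues.

(** * Integrals of the powers *)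

Section Integrals.
Context {R : realType} (alpha : nat -> R) (L : {linear linpow alpha -> R}).
Hypothesis alpha_ge0 : forall i, 0 <= alpha i.
Hypothesis alpha0 : alpha 0%N = 0.
Hypothesis alpha_lt : forall i, alpha i < alpha i.+1.
Hypothesis L_ge0 : forall p : linpow alpha, (forall x, 0 <= x -> 0 <= p x) -> 0 <= L p.
Variable g : nat -> R.
Hypothesis g_positive : forall n, positive_upto L step_fun n g.
Variable mu : {measure set (measurableTypeR R) -> \bar R}.
Hypothesis mu_tail : forall t, mu `]t, +oo[%classic = (tail g t)%:E.

Local Open Scope classical_set_scope.
Local Open Scope ereal_scope.

Let D : set R := `[0%R, +oo[.
Let mass : R := L (monom alpha 0).

Lemma measurable_power_fun (a : R) (A : set R) :
  measurable_fun A (EFin \o power a).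
Proof.
apply: measurableT_comp => //.
by apply: (@measurable_funS _ _ _ _ setT) => //; exact: measurable_powR.
Qed.

Lemma mu_halfline : mu D = mass%:E.
Proof.
have tn := tail_neg alpha0 g_positive.
by rewrite /D (tail_measure_ge0 mu_tail) ?tn ?ltrN10 // => t t0; rewrite !tn ?ltrN10.
Qed.

Lemma integral_monom0 : \int[mu]_(x in D) (monom alpha 0 x)%:E = (L (monom alpha 0))%:E.
Proof.
rewrite (eq_integral (cst 1%E)); last by move=> x _; rewrite monom0E.
by rewrite integral_cst ?mul1e ?mu_halfline //; exact: measurable_itv.
Qed.

Variable i : nat.
Hypothesis i0 : (0 < i)%N.

Let layers M e (x : R) : \bar R := \sum_(j < M) e%:E * (\1_`]level alpha i e j.+1, +oo[ x)%:E.

Lemma layersE M e x : (0 <= e)%R -> D x -> layers M e x = (layer_sum M e (x `^ alpha i))%:E.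
Proof.
move=> e0; rewrite /D /= in_itv /= andbT => x0.
rewrite /layers /layer_sum -sumEFin; apply: eq_bigr => j _.
rewrite -EFinM; congr (e * _)%:E; rewrite indicE -(level_lt alpha0 alpha_lt i0) //.
by congr (nat_of_bool _)%:R; apply/idP/idP; rewrite ?inE /= in_itv /= andbT.
Qed.

Lemma measurable_layers M e : measurable_fun D (layers M e).
Proof.
by apply: emeasurable_sum => j; apply: measurable_funeM; exact: measurableT_comp.
Qed.

Lemma layers_ge0 M e x : (0 <= e)%R -> 0 <= layers M e x.
Proof. by move=> e0; apply: sume_ge0 => j _; rewrite -EFinM lee_fin mulr_ge0. Qed.

Lemma integral_layers M e : (0 <= e)%R ->
  \int[mu]_(x in D) layers M e x =
  (\sum_(j < M) e * tail g (level alpha i e j.+1))%:E.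
Proof.
move=> e0; have mD : measurable (D : set (measurableTypeR R)) by exact: measurable_itv.
have mI j : measurable_fun D
    (fun x => (\1_`]level alpha i e j.+1, +oo[ x)%:E : \bar R).
  exact: measurableT_comp.
rewrite /layers ge0_integral_sum //; first last.
- by move=> j x _; rewrite -EFinM lee_fin mulr_ge0.
- by move=> j; apply: measurable_funeM; exact: mI.
rewrite -sumEFin; apply: eq_bigr => j _.
rewrite ge0_integralZl_EFin //; last exact: mI.
rewrite integral_indic //.
have levD : `]level alpha i e j.+1, +oo[ `<=` D.
  move=> x; rewrite /D /= !in_itv /= !andbT => h.
  exact: le_trans (powR_ge0 _ _) (ltW h).
by rewrite (setIidl levD) mu_tail EFinM.
Qed.

Lemma layers_le_monom M e x : (0 <= e)%R -> D x -> layers M e x <= (monom alpha i x)%:E.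
Proof.
move=> e0 Dx; rewrite layersE // lee_fin monomE layer_sum_le ?powR_ge0 //.
Qed.

(** The layers lie below the power, and by [layer_tail_ge] their integral falls
    short of the value of [L] by an arbitrarily small amount. *)
Lemma L_le_integral : (L (monom alpha i))%:E <= \int[mu]_(x in D) (monom alpha i x)%:E.
Proof.
have mD : measurable (D : set (measurableTypeR R)) by exact: measurable_itv.
set K := L (monom alpha i.+1).
have K0 : (0 <= K)%R by apply: L_ge0 => x _; rewrite monomE powR_ge0.
have m0 : (0 <= mass)%R by apply: L_ge0 => x _; rewrite monomE powR_ge0.
apply/lee_addgt0Pr => eta eta0.
pose e := (eta / (2 * (2 * mass + 1)))%R.
pose d := (eta / (2 * (K + 1)))%R.
have e0 : (0 < e)%R by rewrite divr_gt0 // mulr_gt0 //; lra.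
have d0 : (0 < d)%R by rewrite divr_gt0 // mulr_gt0 //; lra.
have [M /(_ M (leqnn M)) HM] := layer_tail_ge alpha0 alpha_lt g_positive i0 e0 d0.
apply: (@le_trans _ _ (\int[mu]_(x in D) layers M e x + eta%:E)); last first.
  apply: leeD2r; apply: ge0_le_integral => //.
  - by move=> x _; apply: layers_ge0; exact: ltW.
  - exact: measurable_layers.
  - exact: measurable_power_fun.
  - by move=> x Dx; apply: layers_le_monom => //; exact: ltW.
rewrite integral_layers ?(ltW e0) // -EFinD lee_fin; apply: le_trans HM _.
rewrite -addrA lerD2l -/mass -/K.
have -> : eta = (e * (2 * mass + 1) + d * (K + 1))%R.
  by rewrite /e /d; field; apply/andP; split; rewrite gt_eqF //; lra.
by nra.
Qed.

(** On each bounded interval the power exceeds the sum of sufficiently many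
    layers by at most [e]; exhaust the half-line by such intervals. *)
Lemma integral_le_L : \int[mu]_(x in D) (monom alpha i x)%:E <= (L (monom alpha i))%:E.
Proof.
have mD : measurable (D : set (measurableTypeR R)) by exact: measurable_itv.
have m0 : (0 <= mass)%R by apply: L_ge0 => x _; rewrite monomE powR_ge0.
pose F n : set (measurableTypeR R) := `[0%R, n%:R].
have FD n : F n `<=` D by move=> x; rewrite /F /D /= !in_itv /= andbT => /andP[].
have UF : \bigcup_n F n = D.
  apply/seteqP; split => [x [n _]|x]; first exact: FD.
  rewrite /D /= in_itv /= andbT => x0; exists (Num.truncn x).+1 => //.
  by rewrite /F /= in_itv /= x0 ltW // truncnS_gt.
have mF n : measurable (F n) by exact: measurable_itv.
have HF n : \int[mu]_(x in F n) (monom alpha i x)%:E <= (L (monom alpha i))%:E.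
  apply/lee_addgt0Pr => eta eta0.
  pose e := (eta / (mass + 1))%R.
  have e0 : (0 < e)%R by rewrite divr_gt0 //; lra.
  pose M := Num.truncn (n%:R `^ alpha i / e).
  have fM x : F n x -> (x `^ alpha i <= M.+1%:R * e)%R.
    rewrite /F /= in_itv /= => /andP[x0 xn].
    have h : (x `^ alpha i <= n%:R `^ alpha i)%R by apply: ge0_ler_powR; rewrite ?nnegrE.
    by rewrite (le_trans h) // -ler_pdivrMr // ltW // truncnS_gt.
  have h1 : \int[mu]_(x in F n) (monom alpha i x)%:E <= \int[mu]_(x in F n) (layers M e x + e%:E).
    apply: ge0_le_integral => //.
    - by move=> x _; rewrite lee_fin monomE powR_ge0.
    - exact: measurable_power_fun.
    - apply: emeasurable_funD => //; exact: measurable_funS (FD n) (measurable_layers M e).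
    - move=> x Fx; rewrite layersE ?(ltW e0) //; last exact: FD Fx.
      by rewrite -EFinD lee_fin monomE layer_sum_ge ?(ltW e0) // fM.
  apply: le_trans h1 _.
  apply: (@le_trans _ _ (\int[mu]_(x in D) (layers M e x + e%:E))).
    apply: ge0_subset_integral => //.
    - by apply: emeasurable_funD => //; exact: measurable_layers.
    - by move=> x _; rewrite adde_ge0 ?layers_ge0 ?lee_fin ?(ltW e0).
  rewrite ge0_integralD //; first last.
  - by move=> x _; rewrite lee_fin ltW.
  - exact: measurable_layers.
  - by move=> x _; rewrite layers_ge0 ?(ltW e0).
  rewrite integral_layers ?(ltW e0) // (integral_cst mu mD e%:E) mu_halfline.
  rewrite -EFinM -!EFinD lee_fin; apply: lerD.
    exact: layer_tail_le.
  by rewrite /e mulrAC ler_pdivrMr; [nra|lra].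
have ndF : nondecreasing_seq F.
  move=> m n mn; apply/subsetPset => x; rewrite /F /= !in_itv /= => /andP[-> h] /=.
  by rewrite (le_trans h) // ler_nat.
have := @ge0_nondecreasing_set_cvg_integral _ _ _ F (EFin \o monom alpha i) mu ndF mF.
rewrite UF => H; have {}H : \int[mu]_(x in F n) (monom alpha i x)%:E @[n --> \oo] -->
    \int[mu]_(x in D) (monom alpha i x)%:E.
  apply: H => n; first exact: measurable_power_fun.
  by move=> x _; rewrite lee_fin monomE powR_ge0.
rewrite -(cvg_lim _ H) //; apply: lime_le; first exact: cvgP H.
by apply: nearW => n; exact: HF.
Qed.

End Integrals.

(** * Moment functionals *)

Section Moments.
Context {R : realType} (alpha : nat -> R) (L : {linear linpow alpha -> R}).
Hypothesis alpha_ge0 : forall i, 0 <= alpha i.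
Hypothesis alpha0 : alpha 0%N = 0.
Hypothesis alpha_lt : forall i, alpha i < alpha i.+1.
Local Open Scope classical_set_scope.

Lemma moment_functional_ge0 : is_moment_functional L ->
  forall p : linpow alpha, (forall x, 0 <= x -> 0 <= p x) -> 0 <= L p.
Proof.
move=> [mu muL] p p0; have [_ Lp] := muL p.
rewrite -lee_fin Lp; apply: integral_ge0 => x; rewrite /= in_itv /= andbT => x0.
by rewrite lee_fin p0.
Qed.

(** Integrals and values of [L] agree on the powers, hence on their span. *)
Lemma nonneg_moment_functional :
  (forall p : linpow alpha, (forall x, 0 <= x -> 0 <= p x) -> 0 <= L p) ->
  is_moment_functional L.
Proof.
move=> L_ge0.
have step_dom k : exists p : linpow alpha, forall x, 0 <= x -> `|step_fun k x| <= p x.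
  exists (monom alpha 0) => x _; rewrite monom0E // ger0_norm ?step_fun_ge0 //.
  by rewrite /step_fun; case: (_ < _).
have [g gpos] := positive_extension L_ge0 step_dom.
have [mu mu_tail] := measure_with_tail (tail_nonincr alpha0 gpos) (tail_rcont alpha0 gpos)
  (tail_lim alpha0 alpha_lt L_ge0 gpos) (tail_ge0 alpha0 gpos).
exists mu.
have int_monom i : (\int[mu]_(x in `[0%R, +oo[) (monom alpha i x)%:E = (L (monom alpha i))%:E)%E.
  case: (posnP i) => [->|i0]; first exact: (integral_monom0 alpha0 gpos mu_tail).
  apply/le_anti/andP; split.
    exact: (integral_le_L alpha_ge0 alpha0 alpha_lt L_ge0 gpos mu_tail i0).
  exact: (L_le_integral alpha0 alpha_lt L_ge0 gpos mu_tail i0).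
have integrable_monom i : mu.-integrable `[0, +oo[ (EFin \o monom alpha i).
  apply/integrableP; split; first exact: measurable_power_fun.
  have -> : (fun x => `|(EFin \o monom alpha i) x|%E) = (fun x => (monom alpha i x)%:E).
    by apply/funext => x; rewrite /= ger0_norm //; exact: powR_ge0.
  by rewrite int_monom ltry.
have integrable_term i c : mu.-integrable `[0, +oo[ (fun x => c%:E * (monom alpha i x)%:E)%E.
  by apply: integrableZl => //; exact: integrable_monom.
move=> f; have [n /(_ n (leqnn n))[c ->]] := linpow_comb f.
have fE : EFin \o comb alpha c n =
    (fun x => \sum_(j < n) (c j)%:E * (monom alpha j x)%:E)%E.
  apply/funext => x; rewrite /= combE /psum -sumEFin.
  by apply: eq_bigr => j _; rewrite EFinM.
split; first by rewrite fE; apply: integrable_sum.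
rewrite -[RHS]/(integral mu _ (EFin \o comb alpha c n)) fE.
rewrite L_comb integral_sum // /pairing -sumEFin; apply: eq_bigr => j _.
rewrite integralZl //; last exact: (integrable_monom j).
by rewrite EFinM; congr (_ * _)%E; exact: esym (int_monom j).
Qed.

End Moments.
Unset Implicit Arguments.
Set Strict Implicit.

Theorem theorem5p3p4 (R : realType) (alpha : nat -> R)
    (alpha_ge0 : forall i, 0 <= alpha i)
    (alpha0 : alpha 0%N = 0)
    (alpha_lt : forall i, alpha i < alpha i.+1)
    (L : {linear linpow alpha -> R}) :
  [<-> is_moment_functional L;
       forall p : linpow alpha,
         (forall x : R, 0 <= x -> 0 <= p x) -> 0 <= L p;
       forall p : linpow alpha,
         (forall x : R, 0 <= x -> 0 < p x) -> 0 <= L p;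
       forall m : nat,
         [/\ forall z : m.-tuple R, path <%R 0 z -> 0 <= L (det_lin alpha 0 z),
             (1 <= m)%N -> forall z : (m.-1).-tuple R,
               path <%R 0 z -> 0 <= L (det_lin alpha 1 z) &
             forall z : m.-tuple R, path <%R 0 z -> 0 <= L (det_lin alpha 1 z)]].
Proof.
tfae.
- exact: moment_functional_ge0.
- by move=> H p p0; apply: H => x /p0/ltW.
- move=> Lpos.
  have Ldet k m (z : m.-tuple R) : path <%R 0 z -> 0 <= L (det_lin alpha k z).
    move=> z0; have [c [_ cE _ cpos]] := confluent_det_psum k alpha_lt alpha_ge0 z0.
    apply/ler_addgt0Pr => e e0.
    pose K := L (monom alpha 0).
    have K0 : 0 <= K by apply: Lpos => x _; rewrite monom0E.
    have d0 : 0 < e / (K + 1) by rewrite divr_gt0 //; lra.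
    apply: (@le_trans _ _ (L (det_lin alpha k z + (e / (K + 1)) *: monom alpha 0))).
      apply: Lpos => x x0.
      rewrite (_ : linpow_fun _ x = confluent_det alpha k z x + e / (K + 1) * monom alpha 0 x) //.
      by rewrite monom0E // mulr1 ltr_wpDl // cE; exact: cpos.
    rewrite linearD linearZ /= lerD2l -[_ *: _]/(_ * K) mulrAC ler_pdivrMr; last by lra.
    by nra.
  by move=> m; split=> [z|_ z|z]; exact: Ldet.
- move=> H; apply: nonneg_moment_functional => //.
  by apply: nonneg_from_determinants => // m z; have [H1 _ H2] := H m; [exact: H1|exact: H2].
Qed.
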